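(* $p'_2\le 0.4155$, where $p'_2=\inf\{p\in[0,1]:\mathrm{RFM}(2,p)\text{ is recurrent}\}$ is the critical drift of the recursive frog model on the rooted binary tree.
   Context: $\mathbb T_d$ is the rooted $d$-ary tree: the infinite tree in which every vertex has exactly $d$ children, with root $\varnothing$. The recursive frog model $\mathrm{RFM}(d,p)$, $p\in[0,1]$: put $\rho=p/(1-p)$ if $p<1/2$ and $\rho=1$ if $p\ge 1/2$. Initially there is one awake frog at the root and one sleeping frog at each non-root vertex of $\mathbb T_d$. At each discrete time step one frog is sampled uniformly from the set of awake (not removed) frogs and performs one step. The initially awake frog at the root moves to a uniformly sampled child at its first step. Any other awake frog that has so far not moved away from the root moves, independently of everything else, to the parent of its current vertex with probability $\rho$, and with probability $1-\rho$ moves away from the root. Moving away from the root always means moving to a uniformly sampled child vertex of the current vertex (possibly the vertex from which the frog just came). Once a frog has moved away from the root, at all of its later steps it continues to move away from the root to a uniformly sampled child. A frog that reaches the root (by moving to it) is removed. A frog that moves away from the root and lands on a site that has already been visited by an awake frog is removed. Whenever an awake frog lands on a site with a sleeping frog, that sleeping frog wakes up and begins its own independent motion according to these rules. Recurrence: $\mathrm{RFM}(d,p)$ is recurrent if the total number of visits (arrivals) of frogs at the root is infinite almost surely. *)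

(* Defs.v *)
From HB Require Import structures.
From mathcomp Require Import all_boot all_order all_algebra finmap.
From mathcomp Require Import all_classical all_reals all_analysis.

Set Implicit Arguments.
Unset Strict Implicit.
Unset Printing Implicit Defensive.
Import Order.TTheory GRing.Theory Num.Theory.

Local Open Scope classical_set_scope.
Local Open Scope fset_scope.
Local Open Scope fmap_scope.
Local Open Scope ring_scope.

(* A vertex of the rooted d-ary tree is the list of child indices on the path
   from the vertex up to the root, the child index of the vertex itself coming
   first. *)
Notation vertex d := (seq 'I_d).

Definition root (d : nat) : vertex d := [::].
Definition parent (d : nat) (v : vertex d) : vertex d := behead v.
Definition child (d : nat) (v : vertex d) (i : 'I_d) : vertex d := i :: v.

(* The frog initially located at vertex x is named x.  [awake] maps the name of
   each frog that is awake and not removed to its current vertex and to a flag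
   telling whether it has already moved away from the root.  [visited] is the
   set of sites visited so far by an awake frog, so the frog named x is asleep
   if and only if x is not in [visited].  [root_visits] is the number of
   arrivals of frogs at the root so far. *)
Record config (d : nat) := Config {
  awake : {fmap vertex d -> vertex d * bool};
  visited : {fset vertex d};
  root_visits : nat }.

Section ConfigChoice.
Variable d : nat.
Let tuple_of (s : config d) := (awake s, visited s, root_visits s).
Let of_tuple t : config d := Config t.1.1 t.1.2 t.2.
Lemma config_can : cancel tuple_of of_tuple. Proof. by case. Qed.
HB.instance Definition _ := Choice.copy (config d) (can_type config_can).
End ConfigChoice.

Definition init_config (d : nat) : config d :=
  Config [fmap].[root d <- (root d, false)] [fset root d] 0.

(* An awake frog lands on w: a frog sleeping at w wakes up. *)
Definition land (d : nat) (w : vertex d) (s : config d) : config d :=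
  if w \in visited s then s
  else Config (awake s).[w <- (w, false)] (w |` visited s) (root_visits s).

(* A move is [None], to the parent, or [Some i], away from the root to the
   child of index i. *)
Definition perform (d : nat) (s : config d) (x : domf (awake s))
    (m : option 'I_d) : config d :=
  let: (v, away) := awake s x in
  match m with
  | None =>
      let w := parent v in
      if w == root d
      then Config (awake s).[~ val x] (visited s) (root_visits s).+1
      else land w
             (Config (awake s).[val x <- (w, away)] (visited s) (root_visits s))
  | Some i =>
      let w := child v i in
      if w \in visited s
      then Config (awake s).[~ val x] (visited s) (root_visits s)
      else land w
             (Config (awake s).[val x <- (w, true)] (visited s) (root_visits s))
  end.

Definition rho (R : realType) (p : R) : R :=
  if p < 2^-1 then p / (1 - p) else 1.

(* Only the initially awake frog is ever located at the root while awake and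
   not removed, namely before its first step. *)
Definition move_prob (R : realType) (d : nat) (p : R) (f : vertex d * bool)
    (m : option 'I_d) : R :=
  let: (v, away) := f in
  if (v == root d) || away
  then (if m is Some _ then d%:R^-1 else 0)
  else (if m is Some _ then (1 - rho p) * d%:R^-1 else rho p).

(* Without awake frogs the configuration does not change any more. *)
Definition trans_prob (R : realType) (d : nat) (p : R) (s s' : config d) : R :=
  if domf (awake s) == fset0 then (s' == s)%:R
  else \sum_(x : domf (awake s)) #|` domf (awake s)|%:R^-1 *
         \sum_(m : option 'I_d)
           move_prob p (awake s x) m * (s' == perform x m)%:R.

(* X is the recursive frog model RFM(d,p) on the probability space (T, P): the
   Markov chain started at [init_config d] with transition probabilities
   [trans_prob p]. *)
Definition is_RFM (R : realType) (d : nat) (p : R) (disp : measure_display)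
    (T : measurableType disp) (P : probability T R) (X : nat -> T -> config d)
    : Prop :=
  (forall (n : nat) (s : config d), measurable (X n @^-1` [set s])) /\
  (forall (n : nat) (s : nat -> config d),
     P [set t | forall i, (i <= n)%N -> X i t = s i] =
     ((s 0%N == init_config d)%:R *
      \prod_(i < n) trans_prob p (s i) (s i.+1))%:E).

Definition infinitely_many_root_visits (d : nat) (c : nat -> config d) : Prop :=
  forall k, exists n, (k <= root_visits (c n))%N.

(* Recurrence depends only on the law of the model, hence not on the
   probability space carrying it. *)
Definition recurrent (R : realType) (d : nat) (p : R) : Prop :=
  forall (disp : measure_display) (T : measurableType disp)
    (P : probability T R) (X : nat -> T -> config d),
    is_RFM p P X ->
    {ae P, forall t, infinitely_many_root_visits (fun n => X n t)}.

(* The infimum is taken in the extended reals, where inf of the empty set is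
   +oo, whereas [inf set0 = 0] in R. *)
Definition critical_drift (R : realType) (d : nat) : \bar R :=
  ereal_inf [set p%:E | p in [set p : R | 0 <= p <= 1 /\ recurrent d p]].

(* Main.v *)
(* Let V be the number of frogs that ever leave, upwards, a subtree entered by
   one frog. The frogs at the top of the subtree are those coming back from the
   first child entered, the sleeping frog, and, if one of these enters the other
   child, an independent second batch, so the generating function f of V is the
   largest solution with 0 <= f <= 1 of
     f(x) = a f(a) (1 - f(b)) + b f(b)^2,
   where a = rho x + (1 - rho) / 2 and b = rho x + 1 - rho.  It is the decreasing
   limit of the iterates f_n of this operator from f_0 = 1, which belong to the
   subtrees truncated at depth n.

   f vanishes on [0, 1[, that is, V is infinite almost surely, as soon as
   a1 f_n(a1) < 2 - 1 / rho for some n, with a1 = (1 + rho) / 2.  Let u be the left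
   limit of f at 1.  If u < 1, the equation gives u <= a1 f(a1) <= a1 u, hence
   u = 0.  If u = 1, then h = 1 - f satisfies h(x) >= h(b) (2 - a1 f(a1) - h(b)), and
   h(x) <= h(b) / rho because f is convex; as h(b) > 0 tends to 0, this gives
   a1 f(a1) >= 2 - 1 / rho.  For p = 71/171, rho = 71/100 and n = 4 suffices.

   To relate the chain to f_n, one computes, as a function of the configuration,
   the conditional expectation of y^(visits to the root) in the truncated model
   if all moves were carried out.  It is a supermartingale, and equals
   y^(visits so far) unless a relevant frog is left at depth at most n.  These
   frogs have a bounded number of moves, while each is chosen at time i with
   probability at least 1/(i+2).  The harmonic series diverges, so the probability
   that some relevant frog is left has inferior limit 0. *)

From HB Require Import structures.
From mathcomp Require Import all_boot all_order all_algebra finmap.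
From mathcomp Require Import all_classical all_reals all_analysis.
From mathcomp Require Import ring lra zify.
Require Import Defs.

Set Implicit Arguments.
Unset Strict Implicit.
Unset Printing Implicit Defensive.
Import Order.TTheory GRing.Theory Num.Theory.
Import numFieldNormedType.Exports.

Local Open Scope classical_set_scope.
Local Open Scope fset_scope.
Local Open Scope fmap_scope.
Local Open Scope ring_scope.

(** * The recursion for the generating functions *)

Section GeneratingFunction.
Variables (R : realType) (r : R).
Hypothesis r01 : 0 < r < 1.

(* Generating functions of a frog that has to move up or to one given child,
   respectively up or to any child. *)
Definition pass_one (x : R) := r * x + (1 - r) / 2.
Definition pass_all (x : R) := r * x + (1 - r).

Definition gen_step (f : R -> R) (x : R) : R :=
  pass_one x * f (pass_one x) * (1 - f (pass_all x)) +
  pass_all x * f (pass_all x) ^+ 2.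

Definition gen (n : nat) : R -> R := iter n gen_step (fun=> 1).
Arguments gen n x : simpl never.

Lemma genS n x : gen n.+1 x = gen_step (gen n) x. Proof. by []. Qed.

Lemma pass_one_itv x : 0 <= x <= 1 -> 0 <= pass_one x <= 1.
Proof.
move: r01 => /andP[r0 r1] /andP[x0 x1]; have h := mulr_ge0 (ltW r0) x0.
have : 0 <= r * (1 - x) by apply: mulr_ge0; lra.
by rewrite /pass_one => ?; apply/andP; split; lra.
Qed.

Lemma pass_all_itv x : 0 <= x <= 1 -> 0 <= pass_all x <= 1.
Proof.
move: r01 => /andP[r0 r1] /andP[x0 x1]; have h := mulr_ge0 (ltW r0) x0.
have : 0 <= r * (1 - x) by apply: mulr_ge0; lra.
by rewrite /pass_all => ?; apply/andP; split; lra.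
Qed.

Lemma pass_one_le_all x : pass_one x <= pass_all x.
Proof. by move: r01 => /andP[? ?]; rewrite /pass_one /pass_all; lra. Qed.

Lemma gen_itv n x : 0 <= x <= 1 -> 0 <= gen n x <= 1.
Proof.
elim: n x => [|n IH] x x01; first by rewrite /gen /= ler01 lexx.
rewrite genS /gen_step.
have /andP[a0 a1] := pass_one_itv x01; have /andP[b0 b1] := pass_all_itv x01.
have /andP[] := IH _ (pass_one_itv x01); have /andP[] := IH _ (pass_all_itv x01).
move: (gen n _) (gen n _) => fa fb fb0 fb1 fa0 fa1.
(* The new value is [u * (1 - fb) + v] with [0 <= u <= 1] and [0 <= v <= fb], hence at most
   [(1 - fb) + fb]. *)
have afa : 0 <= pass_one x * fa <= 1 by nra.
have bfb : 0 <= pass_all x * fb ^+ 2 <= fb by rewrite expr2; nra.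
move: afa bfb; move: (_ * fa) (_ * fb ^+ 2) => u v /andP[u0 u1] /andP[v0 v1].
have := mulr_ge0 u0 (_ : 0 <= 1 - fb); have : 0 <= (1 - u) * (1 - fb).
  by rewrite mulr_ge0 // subr_ge0.
rewrite subr_ge0 => h /(_ fb1) h'; apply/andP; split; lra.
Qed.

Lemma gen_ge0 n x : 0 <= x <= 1 -> 0 <= gen n x.
Proof. by move=> /(gen_itv n)/andP[]. Qed.

Lemma gen_le1 n x : 0 <= x <= 1 -> gen n x <= 1.
Proof. by move=> /(gen_itv n)/andP[]. Qed.

(** Monotonicity of [gen] in the point and in the depth both reduce to this. Only the growth in [f]
    is delicate, because of the term [- A * f]; it is [(f' - f) * (b' * f' - A' + b' * f)], and
    [A' <= b' * f'] makes it nonnegative. *)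
Lemma combine_le (A A' b b' f f' : R) : 0 <= A <= A' -> 0 <= b <= b' ->
  0 <= f <= f' -> f' <= 1 -> A' <= b' * f' ->
  A * (1 - f) + b * f ^+ 2 <= A' * (1 - f') + b' * f' ^+ 2.
Proof.
move=> /andP[A0 AA] /andP[b0 bb] /andP[f0 ff] f1 Abf.
have h1 : A * (1 - f) <= A' * (1 - f) by apply: ler_wpM2r => //; lra.
have h2 : b * f ^+ 2 <= b' * f ^+ 2 by apply: ler_wpM2r => //; exact: exprn_ge0.
have h3 : 0 <= (f' - f) * (b' * f' - A' + b' * f).
  by apply: mulr_ge0; [lra|apply: addr_ge0; [lra|apply: mulr_ge0; lra]].
have -> : A' * (1 - f') + b' * f' ^+ 2 = A' * (1 - f) + b' * f ^+ 2 +
   (f' - f) * (b' * f' - A' + b' * f) by ring.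
by lra.
Qed.

Lemma gen_homo n x y : 0 <= x -> x <= y -> y <= 1 -> gen n x <= gen n y.
Proof.
elim: n x y => [|n IH] x y x0 xy y1 //.
have x01 : 0 <= x <= 1 by lra.
have y01 : 0 <= y <= 1 by lra.
have /andP[ax0 ax1] := pass_one_itv x01; have /andP[bx0 bx1] := pass_all_itv x01.
have /andP[ay0 ay1] := pass_one_itv y01; have /andP[by0 by1] := pass_all_itv y01.
have axy : pass_one x <= pass_one y by rewrite /pass_one lerD2r ler_wpM2l //; case/andP: r01 => /ltW.
have bxy : pass_all x <= pass_all y by rewrite /pass_all lerD2r ler_wpM2l //; case/andP: r01 => /ltW.
have aby := pass_one_le_all y.
rewrite !genS /gen_step; apply: combine_le.
- by rewrite mulr_ge0 ?gen_ge0 ?ler_pM ?gen_ge0 ?IH ?ax0.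
- by rewrite bx0.
- by rewrite gen_ge0 ?IH ?bx0.
- by rewrite gen_le1 ?by0.
- by rewrite ler_pM ?gen_ge0 ?IH ?ay0.
Qed.

Lemma gen_noninc n x : 0 <= x <= 1 -> gen n.+1 x <= gen n x.
Proof.
elim: n x => [|n IH] x x01; first exact: (gen_le1 1).
have axI := pass_one_itv x01; have bxI := pass_all_itv x01.
rewrite genS [leRHS]genS /gen_step; apply: combine_le.
- by rewrite mulr_ge0 ?gen_ge0 ?ler_wpM2l ?IH //; case/andP: axI.
- by case/andP: bxI => ->; rewrite lexx.
- by rewrite gen_ge0 ?IH.
- by rewrite gen_le1.
- case/andP: axI => ? ?; case/andP: bxI => ? ?.
  by rewrite ler_pM ?gen_ge0 ?gen_homo ?pass_one_le_all //; apply/andP.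
Qed.

Lemma gen1E x : gen 1 x = pass_all x.
Proof. by rewrite genS /gen_step /gen /=; ring. Qed.

(** * Convexity of the iterates, through polynomials with nonnegative coefficients *)

Definition nncoef (p : {poly R}) := forall i, 0 <= p`_i.

Lemma nncoefC c : 0 <= c -> nncoef c%:P.
Proof. by move=> c0 i; rewrite coefC; case: ifP. Qed.

Lemma nncoefX : nncoef 'X.
Proof. by move=> i; rewrite coefX ler0n. Qed.

Lemma nncoefD p q : nncoef p -> nncoef q -> nncoef (p + q).
Proof. by move=> p0 q0 i; rewrite coefD addr_ge0. Qed.

Lemma nncoefM p q : nncoef p -> nncoef q -> nncoef (p * q).
Proof.
by move=> p0 q0 i; rewrite coefM; apply: sumr_ge0 => j _; exact: mulr_ge0.
Qed.

Lemma nncoef_cons p c : nncoef (p * 'X + c%:P) -> nncoef p /\ 0 <= c.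
Proof.
move=> H; split=> [i|].
  by have := H i.+1; rewrite coefD coefMX coefC /= addr0.
by have := H 0%N; rewrite coefD coefMX coefC /= add0r.
Qed.

Lemma nncoef_ind (P : {poly R} -> Prop) : P 0 ->
  (forall p c, nncoef p -> 0 <= c -> P p -> P (p * 'X + c%:P)) ->
  forall p, nncoef p -> P p.
Proof.
move=> P0 PS; elim/poly_ind => // p c IH /nncoef_cons[p0 c0].
by apply: PS => //; exact: IH.
Qed.

Lemma nncoef_comp p q : nncoef p -> nncoef q -> nncoef (p \Po q).
Proof.
move=> + q0; elim/nncoef_ind: p / => [|p c p0 c0 IH].
  by rewrite comp_poly0 => i; rewrite coef0.
rewrite comp_polyD comp_polyM comp_polyX comp_polyC.
by apply: nncoefD; [exact: nncoefM|exact: nncoefC].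
Qed.

Lemma nncoef_horner_ge0 p x : nncoef p -> 0 <= x -> 0 <= p.[x].
Proof.
move=> + x0; elim/nncoef_ind: p / => [|p c p0 c0 IH]; first by rewrite horner0.
by rewrite hornerMXaddC addr_ge0 ?mulr_ge0.
Qed.

Lemma nncoef_homo p x y : nncoef p -> 0 <= x <= y -> p.[x] <= p.[y].
Proof.
move=> + /andP[x0 xy]; elim/nncoef_ind: p / => [|p c p0 c0 IH].
  by rewrite !horner0.
by rewrite !hornerMXaddC lerD2r ler_pM ?nncoef_horner_ge0.
Qed.

Lemma nncoef_convex p (s x : R) : nncoef p -> 0 <= s <= 1 -> 0 <= x <= 1 ->
  p.[s * x + (1 - s)] <= s * p.[x] + (1 - s) * p.[1].
Proof.
move=> + s01 x01; elim/nncoef_ind: p / => [|p c p0 c0 IH].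
  by rewrite !horner0; lra.
rewrite !hornerMXaddC; set m := s * x + (1 - s).
have m0 : 0 <= m by rewrite /m; nra.
have h1 := ler_wpM2r m0 IH.
have h2 : p.[x] <= p.[1] by apply: nncoef_homo.
(* The slack gained on multiplying by the variable is [s * (1 - s) * (1 - x) * (p.[1] - p.[x])]. *)
have h3 : 0 <= s * (1 - s) * (1 - x) by rewrite !mulr_ge0 //; lra.
have := ler_wpM2l h3 h2.
rewrite /m in h1 *; lra.
Qed.

Lemma nncoef_comp_sub p q e : nncoef p -> nncoef q -> 0 <= e ->
  nncoef ((p \Po (q + e%:P)) - (p \Po q)).
Proof.
move=> + q0 e0; have en := nncoefC e0; have qe := nncoefD q0 en.
elim/nncoef_ind: p / => [|p c p0 c0 IH].
  by rewrite !comp_poly0 subr0 => i; rewrite coef0.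
rewrite !comp_polyD !comp_polyM !comp_polyX !comp_polyC.
set P := p \Po (_ + _) in IH *; set Q := p \Po q in IH *.
have -> : P * (q + e%:P) + c%:P - (Q * q + c%:P) = (P - Q) * (q + e%:P) + e%:P * Q.
  by ring.
by apply: nncoefD; apply: nncoefM => //; exact: nncoef_comp.
Qed.

(** The subtraction in [gen_step] hides the signs of the coefficients. With [G = 'X * F] the step
    reads [G(a) + (G(b) - G(a)) * F(b)], where [b] is [a] plus a nonnegative constant, so
    [nncoef_comp_sub] applies to the difference. *)
Fixpoint gen_poly n : {poly R} :=
  if n is m.+1 then
    let a := r%:P * 'X + ((1 - r) / 2)%:P in
    let b := a + ((1 - r) / 2)%:P in
    let F := gen_poly m in let G := 'X * F in
    (G \Po a) + ((G \Po b) - (G \Po a)) * (F \Po b)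
  else 1%:P.

Lemma gen_poly_nneg n : nncoef (gen_poly n).
Proof.
elim: n => [|n IH] /=; first exact: nncoefC.
have /andP[r0 r1] := r01; have e0 : 0 <= (1 - r) / 2 by lra.
have en := nncoefC e0; have G0 := nncoefM nncoefX IH.
have a0 := nncoefD (nncoefM (nncoefC (ltW r0)) nncoefX) en.
apply: nncoefD; first exact: nncoef_comp.
apply: nncoefM; first exact: nncoef_comp_sub.
by apply: nncoef_comp => //; exact: nncoefD.
Qed.

Lemma horner_gen_poly n x : (gen_poly n).[x] = gen n x.
Proof.
elim: n x => [|n IH] x /=; first by rewrite hornerC.
rewrite !(hornerE, horner_comp, IH) genS /gen_step.
rewrite -/(pass_one x).
have -> : r * x + (1 - r) / 2 + (1 - r) / 2 = pass_all x by rewrite /pass_all; lra.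
ring.
Qed.

Lemma gen_at1 n : gen n 1 = 1.
Proof.
elim: n => // n IH; rewrite genS /gen_step.
by have -> : pass_all 1 = 1; [rewrite /pass_all; ring|rewrite IH; ring].
Qed.

Lemma gen_convex n x : 0 <= x <= 1 -> gen n (pass_all x) <= r * gen n x + (1 - r).
Proof.
move=> x01; rewrite -!horner_gen_poly.
apply: le_trans (nncoef_convex (gen_poly_nneg n) _ x01) _; first by case/andP: r01 => /ltW -> /ltW ->.
by rewrite (horner_gen_poly n 1) gen_at1 mulr1.
Qed.

(** * The limit of the iterates and the criterion for its vanishing *)

Definition gen_lim (x : R) : R := limn (gen ^~ x).

Lemma cvg_gen x : 0 <= x <= 1 -> gen n x @[n --> \oo] --> gen_lim x.
Proof.
move=> x01; apply: nonincreasing_is_cvgn.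
  by apply/nonincreasing_seqP => n; exact: gen_noninc.
by exists 0 => _ [n _ <-]; exact: gen_ge0.
Qed.

Lemma gen_lim_le n x : 0 <= x <= 1 -> gen_lim x <= gen n x.
Proof.
move=> x01; apply: nonincreasing_cvgn_ge; last exact: cvg_gen.
by apply/nonincreasing_seqP => m; exact: gen_noninc.
Qed.

Lemma gen_lim_ge0 x : 0 <= x <= 1 -> 0 <= gen_lim x.
Proof.
move=> x01; apply: (cvgr_to_ge (cvg_gen x01)).
by apply: nearW => n; exact: gen_ge0.
Qed.

Lemma gen_lim_homo x y : 0 <= x -> x <= y -> y <= 1 -> gen_lim x <= gen_lim y.
Proof.
move=> x0 xy y1; apply: (ler_cvg_to (@cvg_gen x _) (@cvg_gen y _)); try lra.
by apply: nearW => n; exact: gen_homo.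
Qed.

Lemma gen_lim_convex x : 0 <= x <= 1 ->
  gen_lim (pass_all x) <= r * gen_lim x + (1 - r).
Proof.
move=> x01; have cb := cvg_gen (pass_all_itv x01).
have cr : r * gen n x + (1 - r) @[n --> \oo] --> r * gen_lim x + (1 - r).
  by apply: cvgD; [apply: cvgMl_tmp; exact: cvg_gen|exact: cvg_cst].
by apply: (ler_cvg_to cb cr); apply: nearW => n; exact: gen_convex.
Qed.

Lemma gen_lim_fix x : 0 <= x <= 1 -> gen_lim x = gen_step gen_lim x.
Proof.
move=> x01; have aI := pass_one_itv x01; have bI := pass_all_itv x01.
have h : gen n.+1 x @[n --> \oo] --> gen_step gen_lim x.
  rewrite /gen_step; under eq_fun do rewrite genS /gen_step.
  apply: cvgD; first apply: cvgM.
  - by apply: cvgMl_tmp; exact: cvg_gen.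
  - by apply: cvgB; [exact: cvg_cst|exact: cvg_gen].
  - by apply: cvgMl_tmp; rewrite expr2; under eq_fun do rewrite expr2; apply: cvgM;
      exact: cvg_gen.
apply: (cvg_unique _ _ h) => //.
by have := cvg_gen x01; rewrite -cvg_shiftS.
Qed.

Lemma pass_all_orbit k x :
  pass_all (1 - r ^+ k * (1 - x)) = 1 - r ^+ k.+1 * (1 - x).
Proof. by rewrite /pass_all exprS; ring. Qed.

Lemma gen_lim_eq0 n x : (1 + r) / 2 * gen n ((1 + r) / 2) < 2 - r^-1 ->
  0 <= x < 1 -> gen_lim x = 0.
Proof.
set a1 := (1 + r) / 2 => small /andP[x0 x1].
have /andP[r0 r1] := r01.
have a1I : 0 <= a1 <= 1 by rewrite /a1; lra.
(* [y] is the orbit of [x] under [pass_all] and increases to 1, so the limit of [v] is the left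
   limit of [gen_lim] at 1. *)
pose y k := 1 - r ^+ k * (1 - x).
pose v k := gen_lim (y k).
have rk k : 0 < r ^+ k <= 1 by rewrite exprn_gt0 //= exprn_ile1 // ltW.
have yI k : 0 <= y k <= 1 by have := rk k; rewrite /y; nra.
have ylt1 k : y k < 1 by have := rk k; rewrite /y; nra.
have yS k : pass_all (y k) = y k.+1 by exact: pass_all_orbit.
have vS k : v k <= v k.+1.
  apply: gen_lim_homo; have := yI k; have := yI k.+1; have := ylt1 k => ? ? ?; try lra.
  by rewrite -yS /pass_all; nra.
have vI k : 0 <= v k <= 1.
  by rewrite gen_lim_ge0 //= (le_trans (gen_lim_le 0 (yI k))).
have cv : cvgn v.
  apply: nondecreasing_is_cvgn; first exact/nondecreasing_seqP.
  by exists 1 => _ [k _ <-]; case/andP: (vI k).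
have v_le_lim k : v k <= limn v.
  by apply: nondecreasing_cvgn_le => //; exact/nondecreasing_seqP.
set u := limn v in v_le_lim.
pose kap := a1 * gen_lim a1.
have kap_small : kap < 2 - r^-1.
  apply: le_lt_trans small; rewrite ler_wpM2l ?gen_lim_le //; by case/andP: a1I.
have vrec k : v k <= kap * (1 - v k.+1) + v k.+1 ^+ 2.
  rewrite {1}/v gen_lim_fix // /gen_step yS -/(v k.+1).
  have /andP[v0 v1] := vI k.+1.
  have aI := pass_one_itv (yI k); have ya : pass_one (y k) <= a1.
    by have := ylt1 k; rewrite /pass_one /a1; nra.
  apply: lerD.
    rewrite ler_wpM2r ?subr_ge0 // ler_pM ?gen_lim_ge0 ?gen_lim_homo //; lra.
  by rewrite ler_piMl ?sqr_ge0 //; case/andP: (yI k.+1).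
have cvS : v k.+1 @[k --> \oo] --> u by have := cv; rewrite -cvg_shiftS.
have ule : u <= kap * (1 - u) + u ^+ 2.
  have c : kap * (1 - v k.+1) + v k.+1 ^+ 2 @[k --> \oo] --> kap * (1 - u) + u ^+ 2.
    apply: cvgD; first by apply: cvgMl_tmp; apply: cvgB => //; exact: cvg_cst.
    by rewrite expr2; under eq_fun do rewrite expr2; exact: cvgM.
  by apply: (ler_cvg_to cv c); exact: nearW.
have u0 : 0 <= u by apply: le_trans (v_le_lim 0%N); case/andP: (vI 0%N).
have u1 : u <= 1 by apply: (limr_le cv); apply: nearW => k; case/andP: (vI k).
have y0 : y 0%N = x by rewrite /y; ring.
have r_pow : r ^+ k @[k --> \oo] --> 0 by apply: cvg_expr; rewrite gtr0_norm.
have a1u : gen_lim a1 <= u.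
  (* As [1 - a1 = (1 - r) / 2], this is when the orbit has passed [a1]. *)
  have : \forall k \near \oo, r ^+ k < (1 - r) / 2.
    by apply: (cvgr_lt _ r_pow); lra.
  case=> k _ /(_ k (leqnn k)) /= rkl; apply: le_trans (v_le_lim k).
  apply: gen_lim_homo; have := yI k; rewrite ?/a1; try lra.
  by have := rk k; rewrite /y; nra.
have [u_lt1|u_ge1] := ltP u 1.
  have uk : u <= kap by nra.
  have : u <= a1 * u by apply: le_trans uk _; rewrite ler_wpM2l //; lra.
  have := v_le_lim 0%N; rewrite /v y0 => vu h.
  have : u <= 0 by rewrite /a1 in h; nra.
  by have := gen_lim_ge0 (_ : 0 <= x <= 1); lra.
have {u1 u_ge1 ule a1u}ueq : u = 1 by lra.
have : \forall k \near \oo, v k.+1 > kap + r^-1 - 1.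
  by apply: (cvgr_gt _ cvS); rewrite ueq; lra.
case=> k _ /(_ k (leqnn k)) /= vk.
(* Strictness comes from the first iterate, which is [pass_all]. *)
have vk1 : v k.+1 < 1.
  apply: le_lt_trans (gen_lim_le 1 (yI k.+1)) _; rewrite gen1E yS; exact: ylt1.
have := gen_lim_convex (yI k); rewrite yS -/(v k.+1) -/(v k) => conv.
have := vrec k.
have h : 1 - v k <= r^-1 * (1 - v k.+1) by rewrite -ler_pdivrMl ?invr_gt0 // invrK; lra.
(* [vrec] bounds [1 - v k] below by [(1 - v k.+1) * (1 + v k.+1 - kap)], and convexity bounds it
   above by [r^-1 * (1 - v k.+1)]. *)
suff : 0 < (1 - v k.+1) * (1 + v k.+1 - kap - r^-1) by move=> ? ?; lra.
by rewrite mulr_gt0; lra.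
Qed.

Lemma gen_vanish n x : (1 + r) / 2 * gen n ((1 + r) / 2) < 2 - r^-1 ->
  0 <= x < 1 -> gen m x @[m --> \oo] --> 0.
Proof.
move=> small x01; rewrite -(gen_lim_eq0 small x01); apply: cvg_gen.
by case/andP: x01 => -> /ltW.
Qed.

(** By monotonicity, points and values may be rounded up at every level of a numerical
    evaluation. *)
Lemma gen_step_le n x a b ua ub : 0 <= x <= 1 ->
  pass_one x <= a -> pass_all x <= b -> a <= 1 -> b <= 1 ->
  gen n a <= ua -> gen n b <= ub -> ub <= 1 -> a * ua <= b * ub ->
  gen n.+1 x <= a * ua * (1 - ub) + b * ub ^+ 2.
Proof.
move=> x01 xa xb a_le1 b_le1 ha hb ub1 hab; rewrite genS.
have aI := pass_one_itv x01; have bI := pass_all_itv x01.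
have /andP[a0 _] := aI; have /andP[b0 _] := bI.
apply: combine_le => //.
- rewrite mulr_ge0 ?gen_ge0 //= ler_pM ?gen_ge0 //.
  by apply: le_trans ha; exact: gen_homo.
- by rewrite b0.
- by rewrite gen_ge0 //=; apply: le_trans hb; exact: gen_homo.
Qed.

End GeneratingFunction.
(* The points and the values are rounded up to multiples of 1/1000. *)
Lemma gen_small (R : realType) (r : R) : r = 71 / 100 ->
  (1 + r) / 2 * gen r 4 ((1 + r) / 2) < 2 - r^-1.
Proof.
move=> rE; have r01 : 0 < r < 1 by rewrite rE; lra.
have gen1 x v : r * x + (1 - r) <= v -> gen r 1 x <= v by rewrite gen1E.
have step n x a b ua ub v : 0 <= x <= 1 ->
    gen r n a <= ua -> gen r n b <= ub ->
    r * x + (1 - r) / 2 <= a -> r * x + (1 - r) <= b -> a <= 1 -> b <= 1 ->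
    ub <= 1 -> a * ua <= b * ub ->
    a * ua * (1 - ub) + b * ub ^+ 2 <= v -> gen r n.+1 x <= v.
  move=> x01 ha hb xa xb a1 b1 ub1 hab; apply: le_trans.
  exact: gen_step_le.
(* The points form the binary tree obtained from [(1 + r) / 2 = 171 / 200] by [pass_one] and
   [pass_all]; it is evaluated from depth 1, where [gen] is affine, up to depth 4. *)
have h0 : gen r 2 (17 / 25) <= 619 / 1000.
  by apply: (@step 1 _ (157 / 250) (773 / 1000) (92 / 125) (839 / 1000)
    _ _ (gen1 _ _ _) (gen1 _ _ _)); clear -rE; lra.
have h1 : gen r 2 (33 / 40) <= 781 / 1000.
  by apply: (@step 1 _ (731 / 1000) (219 / 250) (81 / 100) (114 / 125)
    _ _ (gen1 _ _ _) (gen1 _ _ _)); clear -rE; lra.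
have h2 : gen r 3 (753 / 1000) <= 149 / 250.
  by apply: (@step 2 _ (17 / 25) (33 / 40) (619 / 1000) (781 / 1000)
    _ _ h0 h1); clear -rE; lra.
have h3 : gen r 2 (783 / 1000) <= 183 / 250.
  by apply: (@step 1 _ (701 / 1000) (423 / 500) (197 / 250) (891 / 1000)
    _ _ (gen1 _ _ _) (gen1 _ _ _)); clear -rE; lra.
have h4 : gen r 2 (116 / 125) <= 907 / 1000.
  by apply: (@step 1 _ (201 / 250) (949 / 1000) (861 / 1000) (241 / 250)
    _ _ (gen1 _ _ _) (gen1 _ _ _)); clear -rE; lra.
have h5 : gen r 3 (449 / 500) <= 817 / 1000.
  by apply: (@step 2 _ (783 / 1000) (116 / 125) (183 / 250) (907 / 1000)
    _ _ h3 h4); clear -rE; lra.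
have h6 : gen r 4 (171 / 200) <= 341 / 500.
  by apply: (@step 3 _ (753 / 1000) (449 / 500) (149 / 250) (817 / 1000)
    _ _ h2 h5); clear -rE; lra.
have -> : (1 + r) / 2 = 171 / 200 by clear -rE; lra.
have -> : r^-1 = 100 / 71 by rewrite rE invf_div.
clear -h6; lra.
Qed.

(** * Configurations and moves *)

Section FrogBig.
Variables (d : nat) (T : Type) (idx : T) (op : Monoid.com_law idx).
Variable g : vertex d -> vertex d * bool -> T.
Implicit Types f : {fmap vertex d -> vertex d * bool}.

(** A general commutative monoid serves both the products of frog weights and the sum of frog
    energies. *)
Definition frogs_big f : T :=
  \big[op/idx]_(x <- domf f) oapp (g x) idx f.[? x].

Lemma frogs_big_new f k a : k \notin domf f ->
  frogs_big f.[k <- a] = op (g k a) (frogs_big f).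
Proof.
move=> kf; rewrite /frogs_big.
have dom h : \big[op/idx]_(x <- domf f.[k <- a]) h x =
    op (h k) (\big[op/idx]_(x <- domf f) h x).
  by rewrite dom_setf big_fsetU1.
rewrite dom fnd_set eqxx /=.
congr (op _ _); apply: eq_big_seq => x xf; rewrite fnd_set.
by case: eqP => // xk; rewrite -xk xf in kf.
Qed.

Lemma frogs_big_set f k a :
  frogs_big f.[k <- a] = op (g k a) (frogs_big f.[~ k]).
Proof. by rewrite -setf_rem1 frogs_big_new // mem_remf1 eqxx. Qed.

Lemma frogs_big_rem f k a : f.[? k] = Some a ->
  frogs_big f = op (g k a) (frogs_big f.[~ k]).
Proof.
move=> fk; rewrite -frogs_big_set; congr frogs_big.
by apply/fmapP => x; rewrite fnd_set; case: eqP => // ->.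
Qed.

Lemma frogs_big_idx f : (forall x a, f.[? x] = Some a -> g x a = idx) ->
  frogs_big f = idx.
Proof.
move=> H; rewrite /frogs_big big1_seq // => x /andP[_ xf].
by case fx : f.[? x] => [a|] //=; exact: H fx.
Qed.

End FrogBig.

(** * Ancestors of a vertex as suffixes of a list *)

Section Vertices.
Variable d : nat.
Implicit Types u v w : vertex d.

Lemma suffix_cons i u : suffix u (i :: u).
Proof. exact: (suffix_suffix [:: i]). Qed.

Lemma suffix_child u v : suffix u v -> u != v -> exists i, suffix (i :: u) v.
Proof.
move=> /suffixP[w ->]; case/lastP: w => [|w i]; first by rewrite eqxx.
by move=> _; exists i; rewrite cat_rcons suffix_suffix.
Qed.

Lemma suffix_same_size u v w : suffix u w -> suffix v w -> size u = size v -> u = v.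
Proof.
by rewrite !suffixE => /eqP + /eqP + uv; rewrite uv => -> ->.
Qed.

End Vertices.

(** An invariant that holds from the first step on; [init_config] violates [wf_pos], its frog being
    at the root. *)
Record well_formed d (s : config d) : Prop := WellFormed {
  wf_root : root d \in visited s;
  wf_parent : forall v, v \in visited s -> parent v \in visited s;
  wf_dom : domf (awake s) `<=` visited s;
  wf_pos : forall x u away, (awake s).[? x] = Some (u, away) ->
    u \in visited s /\ u != root d }.

Lemma wf_suffix d (s : config d) u v : well_formed s -> suffix u v ->
  v \in visited s -> u \in visited s.
Proof.
move=> ws /suffixP[w ->]; elim: w => [|i w IH] //= /(wf_parent ws); exact: IH.
Qed.

(** * The effect of a single move on a well-formed configuration *)

Section Perform.
Variables (d : nat) (s : config d) (x : domf (awake s)) (v : vertex d) (away : bool).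
Hypotheses (ws : well_formed s) (xv : awake s x = (v, away)).

Let fx : (awake s).[? val x] = Some (v, away).
Proof. by rewrite -Some_fnd xv. Qed.

Lemma pos_visited : v \in visited s. Proof. by case: (wf_pos ws fx). Qed.

Lemma pos_neq_root : v != root d. Proof. by case: (wf_pos ws fx). Qed.

(** The visited set is closed under parents, so a frog moving up never wakes another one. *)
Lemma perform_up : perform x None =
  if parent v == root d
  then Config (awake s).[~ val x] (visited s) (root_visits s).+1
  else Config (awake s).[val x <- (parent v, away)] (visited s) (root_visits s).
Proof.
rewrite /perform xv; case: ifP => // _.
by rewrite /land /= (wf_parent ws) // pos_visited.
Qed.

Lemma perform_down i : perform x (Some i) =
  if child v i \in visited s
  then Config (awake s).[~ val x] (visited s) (root_visits s)
  else Config (awake s).[val x <- (child v i, true)].[child v i <- (child v i, false)]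
              (child v i |` visited s) (root_visits s).
Proof. by rewrite /perform xv; case: ifP => // vi; rewrite /land /= vi. Qed.

Lemma visited_perform m : visited (perform x m) =
  if m is Some i then child v i |` visited s else visited s.
Proof.
case: m => [i|]; last by rewrite perform_up; case: ifP.
rewrite perform_down; case: ifP => //= vi; apply/fsetP => w.
by rewrite in_fset1U; case: eqP => // ->.
Qed.

Lemma child_neq i : child v i \notin visited s -> child v i != val x.
Proof.
apply: contra => /eqP ->; exact: (fsubsetP (wf_dom ws)) (valP x).
Qed.

Lemma wf_perform m : well_formed (perform x m).
Proof.
have posr k u b : (awake s).[~ val x].[? k] = Some (u, b) ->
    u \in visited s /\ u != root d.
  by rewrite fnd_rem1; case: ifP => // _ /(wf_pos ws).
have sub : domf (awake s).[~ val x] `<=` visited s.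
  apply/fsubsetP => k; rewrite mem_remf1 => /andP[_]; exact: (fsubsetP (wf_dom ws)).
have xvis : val x \in visited s by exact: (fsubsetP (wf_dom ws)) (valP x).
case: m => [i|].
  rewrite perform_down; case: ifP => [_|/negbT vi].
    by split; [exact: wf_root ws|exact: wf_parent ws|exact: sub|exact: posr].
  split => /=.
  - by rewrite in_fset1U (wf_root ws) orbT.
  - move=> w; rewrite !in_fset1U => /predU1P[->|/(wf_parent ws) ->]; last exact: orbT.
    by rewrite pos_visited orbT.
  - apply/fsubsetP => k; rewrite ?dom_setf !in_fset1U.
    by case/or3P => [->|/eqP ->|/(fsubsetP (wf_dom ws)) ->]; rewrite ?xvis ?orbT.
  - move=> k u b; rewrite !fnd_set in_fset1U.
    case: eqP => [_ [<- _]|_]; first by rewrite eqxx.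
    case: eqP => [_ [<- _]|_]; first by rewrite eqxx.
    by move=> /(wf_pos ws)[-> ->]; rewrite orbT.
rewrite perform_up; case: ifP => [_|/negbT pv].
  by split; [exact: wf_root ws|exact: wf_parent ws|exact: sub|exact: posr].
split => /=; [exact: wf_root|exact: wf_parent ws| |].
- apply/fsubsetP => k; rewrite ?dom_setf in_fset1U.
  by case/predU1P => [->//|/(fsubsetP (wf_dom ws))].
- move=> k u b; rewrite fnd_set; case: eqP => [_ [<- _]|_ /(wf_pos ws) //].
  by rewrite pv (wf_parent ws) // pos_visited.
Qed.

Lemma root_visits_perform m : (root_visits s <= root_visits (perform x m))%N.
Proof.
case: m => [i|]; first by rewrite perform_down; case: ifP.
by rewrite perform_up; case: ifP => //= _; exact: leqnSn.
Qed.

(** Linear growth of the number of awake frogs is what bounds the selection probabilities below by a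
    harmonic sequence. *)
Lemma card_awake_perform m :
  (#|` domf (awake (perform x m))| <= #|` domf (awake s)|.+1)%N.
Proof.
have rem : (#|` domf (awake s).[~ val x]| <= #|` domf (awake s)|.+1)%N.
  apply: leqW; apply: fsubset_leq_card; apply/fsubsetP => k.
  by rewrite mem_remf1 => /andP[].
have set : fsval x |` domf (awake s) = domf (awake s).
  by apply/fsetP => k; rewrite in_fset1U; case: eqP => // ->; exact/esym/valP.
case: m => [i|].
  rewrite perform_down; case: ifP => // _ /=; rewrite cardfsU1 set.
  by rewrite -add1n leq_add2r leq_b1.
by rewrite perform_up; case: ifP => // _ /=; rewrite set.
Qed.

Section Observable.
Variables (T : Type) (idx : T) (op : Monoid.com_law idx).
Variable g : vertex d -> vertex d * bool -> T.

Lemma frogs_big_perform m : frogs_big op g (awake (perform x m)) =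
  let rest := frogs_big op g (awake s).[~ val x] in
  match m with
  | None => if parent v == root d then rest
            else op (g (val x) (parent v, away)) rest
  | Some i => if child v i \in visited s then rest
              else op (g (child v i) (child v i, false))
                      (op (g (val x) (child v i, true)) rest)
  end.
Proof.
case: m => [i|] /=; last by rewrite perform_up; case: ifP => // _; exact: frogs_big_set.
rewrite perform_down; case: ifP => // /negbT vi /=.
rewrite frogs_big_new ?frogs_big_set // dom_setf in_fset1U negb_or child_neq //=.
by apply: contra vi; exact: (fsubsetP (wf_dom ws)).
Qed.

Lemma frogs_big_split : frogs_big op g (awake s) =
  op (g (val x) (v, away)) (frogs_big op g (awake s).[~ val x]).
Proof. exact: frogs_big_rem. Qed.

End Observable.
End Perform.

(*BEGIN*)
Lemma sum_moves (V : nmodType) (F : option 'I_2 -> V) :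
  \sum_(m : option 'I_2) F m = F None + (F (Some ord0) + F (Some ord_max)).
Proof.
rewrite (bigD1 None) //=; congr (_ + _).
rewrite (bigD1 (Some ord0)) //=; congr (_ + _).
rewrite (bigD1 (Some ord_max)) //= big1 ?addr0 // => -[[[|[|k]] lt]|] //=.
Qed.

(** * The supermartingale *)

Section Potential.
Variables (R : realType) (p : R) (N : nat).
Let r := rho p.
Hypothesis r01 : 0 < r < 1.
Local Notation conf := (config 2).
Local Notation vert := (vertex 2).
Local Notation gen := (gen r).

(* The parameter [c] is the probability that a move away from the root does not
   enter one of the forbidden children: 1, 1/2 or 0. *)
Definition step_weight (q y c : R) : R := q * y + (1 - q) * c.

Definition up_prob (away : bool) : R := if away then 0 else r.

(* Frogs coming up from below depth [N] are ignored, unless they move away from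
   the root again; otherwise the relevant frogs would not have boundedly many
   moves. *)
Definition counted (x : vert) (away : bool) := away || (size x <= N)%N.

Definition frog_weight (w : vert) (y c : R) (x : vert) (a : vert * bool) : R :=
  if (a.1 == w) && counted x a.2 then step_weight (up_prob a.2) y c else 1.

Definition site_weight (f : {fmap vert -> vert * bool}) (w : vert) (y c : R) : R :=
  frogs_big *%R (frog_weight w y c) f.

(* [node] combines the generating functions of the frogs leaving the visited
   children of a vertex into that of the frogs leaving the vertex, by inclusion
   and exclusion on the set of unvisited children that get entered; a child
   entered later contributes [gen n]. *)
Definition node (n : nat) (W : R -> R) (k0 k1 : option (R -> R)) (y : R) : R :=
  let z0 := step_weight r y 1 in let z1 := step_weight r y 2^-1 in
  let f0 := gen n z0 in let f1 := gen n z1 in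
  match k0, k1 with
  | Some g0, Some g1 => W 1 * (g0 z0 * g1 z0)
  | Some g, None | None, Some g =>
      W 2^-1 * (g z1 * (1 - f0)) + W 1 * (g z0 * f0)
  | None, None =>
      W 0 * ((1 - f0) * (1 + f0 - 2 * f1)) + W 2^-1 * (2 * f1 * (1 - f0)) +
      W 1 * f0 ^+ 2
  end.

(* With [size v + n = N.+1], the generating function of the number of counted
   frogs that are still to leave the subtree of the visited vertex [v] upwards. *)
Fixpoint emission (s : conf) (n : nat) (v : vert) (y : R) : R :=
  if n is m.+1 then
    let kid i := if child v i \in visited s then Some (emission s m (child v i))
                 else None in
    node m (site_weight (awake s) v y) (kid ord0) (kid ord_max) y
  else 1.

Definition kid s n v i :=
  if child v i \in visited s then Some (emission s n (child v i)) else None.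

Definition kids_nonneg (k : option (R -> R)) :=
  if k is Some g then forall y, 0 <= y <= 1 -> 0 <= g y else True.

Lemma step_weight_itv q y c : 0 <= q <= 1 -> 0 <= y <= 1 -> 0 <= c <= 1 ->
  0 <= step_weight q y c <= 1.
Proof.
move=> q01 y01 c01.
have : 0 <= q * y by apply: mulr_ge0; lra.
have : 0 <= (1 - q) * c by apply: mulr_ge0; lra.
have : 0 <= q * (1 - y) by apply: mulr_ge0; lra.
have : 0 <= (1 - q) * (1 - c) by apply: mulr_ge0; lra.
rewrite /step_weight; lra.
Qed.

Lemma up_prob_itv away : 0 <= up_prob away <= 1.
Proof.
by move: r01 => /andP[? ?]; rewrite /up_prob; case: away; lra.
Qed.

Lemma frog_weight_itv w y c x a : 0 <= y <= 1 -> 0 <= c <= 1 ->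
  0 <= frog_weight w y c x a <= 1.
Proof.
move=> y01 c01; rewrite /frog_weight; case: ifP => _; last by rewrite ler01 lexx.
exact/step_weight_itv/c01/y01/up_prob_itv.
Qed.

Lemma frog_weight_off w y c x u away : w != u ->
  frog_weight w y c x (u, away) = 1.
Proof. by rewrite /frog_weight /= eq_sym => /negbTE ->. Qed.

Lemma site_weight_ge0 f w y c : 0 <= y <= 1 -> 0 <= c <= 1 ->
  0 <= site_weight f w y c.
Proof.
move=> y01 c01; apply: prodr_ge0 => x _; case: f.[? x] => [a|] /=; last exact: ler01.
by case/andP: (frog_weight_itv w x a y01 c01).
Qed.

(** * Order, linearity and averaging properties of [node] *)

Section Node.
Variables (n : nat) (y : R).
Hypothesis y01 : 0 <= y <= 1.
Let z0 := step_weight r y 1.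
Let z1 := step_weight r y 2^-1.

Lemma step_weight_all : z0 = pass_all r y.
Proof. by rewrite /z0 /step_weight /pass_all mulr1. Qed.

Lemma step_weight_one : z1 = pass_one r y.
Proof. by []. Qed.

Let z0_itv : 0 <= z0 <= 1.
Proof. rewrite step_weight_all; exact: pass_all_itv. Qed.

Let z1_itv : 0 <= z1 <= 1.
Proof. rewrite step_weight_one; exact: pass_one_itv. Qed.

Let gen_z : [&& 0 <= gen n z1, gen n z1 <= gen n z0 & gen n z0 <= 1].
Proof.
rewrite gen_ge0 //= ?gen_le1 // andbT gen_homo //.
- by case/andP: z1_itv.
- by rewrite step_weight_one step_weight_all pass_one_le_all.
- by case/andP: z0_itv.
Qed.

Lemma node_le (W W' : R -> R) k0 k1 : kids_nonneg k0 -> kids_nonneg k1 ->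
  (forall c, 0 <= c <= 1 -> W c <= W' c) -> node n W k0 k1 y <= node n W' k0 k1 y.
Proof.
move=> h0 h1 WW; have := gen_z; rewrite /node -/z0 -/z1.
set f0 := gen n z0; set f1 := gen n z1 => /and3P[f1_ge0 f1_le f0_le1].
have W0 : W 0 <= W' 0 by apply: WW; lra.
have W1 : W 1 <= W' 1 by apply: WW; lra.
have Wh : W 2^-1 <= W' 2^-1 by apply: WW; lra.
case: k0 h0 => [g0|] h0; case: k1 h1 => [g1|] h1.
- by apply: ler_wpM2r => //; rewrite mulr_ge0 ?h0 ?h1.
- by apply: lerD; apply: ler_wpM2r => //; rewrite mulr_ge0 ?h0 //; lra.
- by apply: lerD; apply: ler_wpM2r => //; rewrite mulr_ge0 ?h1 //; lra.
- apply: lerD; last by apply: ler_wpM2r => //; exact: sqr_ge0.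
  by apply: lerD; apply: ler_wpM2r => //; rewrite !mulr_ge0 //; lra.
Qed.

Lemma node_ge0 W k0 k1 : kids_nonneg k0 -> kids_nonneg k1 ->
  (forall c, 0 <= c <= 1 -> 0 <= W c) -> 0 <= node n W k0 k1 y.
Proof.
move=> h0 h1 WW; apply: le_trans (node_le h0 h1 WW).
by rewrite /node; case: k0 {h0} => [g0|]; case: k1 {h1} => [g1|];
  rewrite ?mul0r ?addr0.
Qed.

Lemma node_eq1 W k0 k1 : (forall c, 0 <= c <= 1 -> W c = 1) ->
  (forall g, k0 = Some g -> forall z, 0 <= z <= 1 -> g z = 1) ->
  (forall g, k1 = Some g -> forall z, 0 <= z <= 1 -> g z = 1) ->
  node n W k0 k1 y = 1.
Proof.
move=> W1 h0 h1; rewrite /node -/z0 -/z1.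
rewrite !W1 ?lexx ?ler01 //; try lra.
case: k0 h0 => [g0|] h0; case: k1 h1 => [g1|] h1.
- by rewrite (h0 _ erefl) ?(h1 _ erefl) // !mul1r.
- by rewrite !(h0 _ erefl) //; ring.
- by rewrite !(h1 _ erefl) //; ring.
- by ring.
Qed.

Definition fill (k : option (R -> R)) := Some (odflt (gen n) k).

(* The effect on [node] of the next move of a frog: up with probability [q], in
   which case it contributes the factor [e], or to either child. *)
Lemma node_average (q e : R) W k0 k1 :
  q * (e * node n W k0 k1 y) + ((1 - q) / 2 * node n W (fill k0) k1 y +
                                (1 - q) / 2 * node n W k0 (fill k1) y) =
  node n (fun c => step_weight q e c * W c) k0 k1 y.
Proof.
by rewrite /node /step_weight /=; case: k0 => [g0|]; case: k1 => [g1|] /=; field.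
Qed.

Lemma node_sym W k0 k1 : node n W k0 k1 y = node n W k1 k0 y.
Proof. by rewrite /node; case: k0 k1 => [g0|] [g1|] //; ring. Qed.

(** Site weight and first child enter [node] only through the products
    [W c * g (step_weight r y c)], with nonnegative coefficients, so an inequality between averages
    passes from a child to its parent. *)
Lemma node_linear (I : finType) (mu : I -> R) (W : I -> R -> R) (g : I -> R -> R)
    (V : R -> R) (h : R -> R) k : kids_nonneg k ->
  (forall c, 0 <= c <= 1 -> 0 <= V c) ->
  (forall c, 0 <= c <= 1 ->
    \sum_i mu i * (W i c * g i (step_weight r y c)) <=
    V c * h (step_weight r y c)) ->
  \sum_i mu i * node n (W i) (Some (g i)) k y <= node n V (Some h) k y.
Proof.
move=> hk V0 H.
have H1 : \sum_i mu i * (W i 1 * g i z0) <= V 1 * h z0 by apply: H; lra.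
have Hh : \sum_i mu i * (W i 2^-1 * g i z1) <= V 2^-1 * h z1 by apply: H; lra.
have := gen_z; rewrite /node -/z0 -/z1.
set f0 := gen n z0; set f1 := gen n z1 => /and3P[f1_ge0 f1_le f0_le1].
case: k hk => [g1|] hk.
  rewrite mulrA; apply: le_trans (ler_wpM2r (hk _ z0_itv) H1).
  by rewrite mulr_suml ler_sum // => i _; rewrite !mulrA.
rewrite !mulrA; under eq_bigr do rewrite mulrDr.
rewrite big_split; apply: lerD.
- apply: le_trans (ler_wpM2r (_ : 0 <= 1 - f0) Hh); last by lra.
  by rewrite mulr_suml ler_sum // => i _; rewrite !mulrA.
- apply: le_trans (ler_wpM2r (_ : 0 <= f0) H1); last by lra.
  by rewrite mulr_suml ler_sum // => i _; rewrite !mulrA.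
Qed.

End Node.

Lemma emissionS s n v y : emission s n.+1 v y =
  node n (site_weight (awake s) v y) (kid s n v ord0) (kid s n v ord_max) y.
Proof. by []. Qed.

Lemma emission_at i s n v y : emission s n.+1 v y =
  node n (site_weight (awake s) v y) (kid s n v i) (kid s n v (rev_ord i)) y.
Proof.
rewrite emissionS; have [->|->] : i = ord0 \/ i = ord_max.
- by case: i => [[|[|k]] lt] //; [left|right]; exact: val_inj.
- by rewrite (_ : rev_ord ord0 = ord_max) //; exact: val_inj.
- by rewrite (_ : rev_ord ord_max = ord0); [exact: node_sym|exact: val_inj].
Qed.

Lemma emission_ge0 s n v y : 0 <= y <= 1 -> 0 <= emission s n v y.
Proof.
elim: n v y => [|n IH] v y y01; first exact: ler01.
rewrite emissionS; apply: node_ge0 => // [||c c01]; last exact: site_weight_ge0.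
- by rewrite /kid; case: ifP => // _ z z01; exact: IH.
- by rewrite /kid; case: ifP => // _ z z01; exact: IH.
Qed.

Lemma kid_nonneg s n v i : kids_nonneg (kid s n v i).
Proof. by rewrite /kid; case: ifP => // _ z z01; exact: emission_ge0. Qed.

Lemma emission_local s s' n u :
  (forall w, suffix u w -> (w \in visited s) = (w \in visited s')) ->
  (forall w, suffix u w -> site_weight (awake s) w = site_weight (awake s') w) ->
  emission s n u = emission s' n u.
Proof.
elim: n u => [|n IH] u hv hw; apply/funext => y //.
have sub i w : suffix (child u i) w -> suffix u w.
  by apply: suffix_trans; exact: suffix_cons.
rewrite !emissionS hw ?suffix_refl // /kid.
by congr (node _ _ _ _ _); rewrite hv ?suffix_cons //; case: ifP => // _;
  congr Some; apply: IH => w /sub; [exact: hv|exact: hw|exact: hv|exact: hw].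
Qed.

Lemma emission_quiet s n v y :
  (forall x u away, (awake s).[? x] = Some (u, away) -> counted x away ->
    (N < size u)%N) ->
  (size v + n)%N = N.+1 -> 0 <= y <= 1 -> emission s n v y = 1.
Proof.
move=> quiet; elim: n v y => [|n IH] v y sz y01 //.
have kid1 i g : kid s n v i = Some g -> forall z, 0 <= z <= 1 -> g z = 1.
  rewrite /kid; case: ifP => // _ [<-] z z01; apply: IH => //.
  by rewrite /= addSnnS.
rewrite emissionS; apply: node_eq1 => // [c c01||]; try exact: kid1.
apply: frogs_big_idx => x [u away] /quiet Q; rewrite /frog_weight /=.
by case: eqP => //= uv; case: ifP => // /Q; rewrite uv; lia.
Qed.

(** A newly entered vertex holds the entering frog, which can only move away and has weight [c], and
    the woken one, of weight [step_weight r y c]. With these weights [node] is exactly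
    [gen_step]. *)
Lemma emission_fresh s n v : (size v + n)%N = N.+1 ->
  (forall i, child v i \notin visited s) ->
  (forall y c, (size v <= N)%N ->
     site_weight (awake s) v y c = c * step_weight r y c) ->
  emission s n v = gen n.
Proof.
case: n => [|n] sz fresh W; apply/funext => y //.
rewrite emissionS /kid !ifN // /node !W; try lia.
by rewrite genS /gen_step step_weight_all step_weight_one; field.
Qed.

(** * The change of the emissions under one move *)

Section Step.
Variables (s : conf) (x : domf (awake s)) (v : vert) (away : bool).
Hypotheses (ws : well_formed s) (xv : awake s x = (v, away)).
Let q := up_prob away.

Lemma move_probE m :
  move_prob p (v, away) m = if m is Some _ then (1 - q) / 2 else q.
Proof.
rewrite /move_prob (negbTE (pos_neq_root ws xv)) /q /up_prob /=.
by case: away => /=; case: m => // i; field.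
Qed.

(** A frog that has just left [u] is no longer seen by the emission of [u], so its factor is
    supplied separately. *)
Definition exit_weight (u : vert) (m : option 'I_2) (y : R) : R :=
  if [&& m == None, u == v & counted (val x) away] then y else 1.

Lemma site_weight_other m w y c : w != v -> (m = None -> w != parent v) ->
  (forall i, m = Some i -> child v i \notin visited s -> w != child v i) ->
  site_weight (awake (perform x m)) w y c = site_weight (awake s) w y c.
Proof.
move=> wv wup wdown; rewrite /site_weight (frogs_big_perform ws xv).
rewrite (frogs_big_split xv) (frog_weight_off _ _ _ _ wv) /= mul1r.
case: m wup wdown => [i _ /(_ i erefl)|/(_ erefl) + _] /=.
  case: ifP => // /negbT vi /(_ isT) wi.
  by rewrite !frog_weight_off // !mul1r.
by case: ifP => // _ wp; rewrite frog_weight_off // mul1r.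
Qed.

Lemma emission_other m u n : ~~ suffix u v -> (m = None -> ~~ suffix u (parent v)) ->
  (forall i, m = Some i -> child v i \notin visited s -> ~~ suffix u (child v i)) ->
  emission (perform x m) n u = emission s n u.
Proof.
move=> uv uup udown; apply: emission_local => w uw.
  rewrite (visited_perform ws xv); case: m udown {uup} => // i /(_ i erefl) ui.
  rewrite in_fset1U; case: eqP => //= wi; rewrite wi in uw *.
  by apply/esym; apply: contraTT uw.
apply/funext => y; apply/funext => c; apply: site_weight_other.
- by apply: contraNneq uv => <-.
- by move=> /uup; apply: contraNneq => <-.
- by move=> i mi /(udown i mi); apply: contraNneq => <-.
Qed.

Lemma site_weight_new i y c : child v i \notin visited s ->
  (size (child v i) <= N)%N ->
  site_weight (awake (perform x (Some i))) (child v i) y c = c * step_weight r y c.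
Proof.
move=> vi sz; rewrite /site_weight (frogs_big_perform ws xv) (negbTE vi).
rewrite frogs_big_idx => [|k [u b]].
  rewrite /frog_weight /counted /= !eqxx (sz : (size v < N)%N) /=.
  by rewrite /step_weight; ring.
rewrite fnd_rem1; case: ifP => // _ /(wf_pos ws)[uvis _].
by apply: frog_weight_off; apply: contraNneq vi => ->.
Qed.

Lemma fresh_kids i j : child v i \notin visited s ->
  child (child v i) j \notin visited (perform x (Some i)).
Proof.
move=> vi; rewrite (visited_perform ws xv) in_fset1U negb_or; apply/andP; split.
  by apply/eqP => /(congr1 size) /=; lia.
by apply: contra vi => /(wf_parent ws).
Qed.

(** A frog entering a visited child is removed and changes nothing there; an unvisited child becomes
    a fresh subtree, described by [gen n]. *)
Lemma kid_perform m n i : (size v + n.+1)%N = N.+1 ->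
  kid (perform x m) n v i =
  if m == Some i then fill n (kid s n v i) else kid s n v i.
Proof.
move=> sz; case: eqP => [->|mi].
  rewrite {1}/kid (visited_perform ws xv) in_fset1U eqxx /= /fill.
  congr Some; rewrite /kid; case: ifP => [vi|vi] /=.
    apply: emission_other => // [|j [<-]]; last by rewrite vi.
    by apply/negP => /size_suffix /=; lia.
  apply: emission_fresh => [|j|y c]; first by rewrite /= addSnnS.
    exact/fresh_kids/negbT.
  by move=> szi; apply: site_weight_new => //; exact/negbT.
rewrite /kid (visited_perform ws xv).
have -> : (child v i \in if m is Some i0 then child v i0 |` visited s else visited s)
    = (child v i \in visited s).
  case: m mi => // j ij; rewrite in_fset1U; case: eqP => // -[ji].
  by case: ij; rewrite ji.
case: ifP => // _; congr Some; apply: emission_other.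
- by apply/negP => /size_suffix /=; lia.
- by move=> _; apply/negP => /size_suffix /=; rewrite size_behead; lia.
- move=> j mj _; apply/negP => /suffix_same_size /(_ (suffix_refl _)) /=.
  by move=> /(_ erefl)[ij]; apply: mi; rewrite mj ij.
Qed.

Lemma site_weight_leave m y c : site_weight (awake (perform x m)) v y c =
  site_weight (awake s).[~ val x] v y c.
Proof.
have vi i : v != child v i by apply/eqP => /(congr1 size) /=; lia.
have vp : v != parent v.
  apply/eqP => /(congr1 size); rewrite size_behead.
  by have := pos_neq_root ws xv; case: (v) => //= a l _; lia.
rewrite /site_weight (frogs_big_perform ws xv) /=; case: m => [i|].
  by case: ifP => // _; rewrite !frog_weight_off // !mul1r.
by case: ifP => // _; rewrite frog_weight_off // mul1r.
Qed.

(** By [node_average] the next move multiplies the weight of the other frogs at [v] by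
    [step_weight q e c]. For a counted frog this is its own weight; otherwise [e = 1], and the
    factor is at most the weight 1. *)
Lemma emission_here n y : (size v + n)%N = N.+1 -> 0 <= y <= 1 ->
  \sum_m move_prob p (v, away) m *
    (exit_weight v m y * emission (perform x m) n v y) <= emission s n v y.
Proof.
move=> sz y01; have q01 : 0 <= q <= 1 by exact: up_prob_itv.
set e := exit_weight v None y.
have e01 : 0 <= e <= 1.
  by rewrite /e /exit_weight; case: ifP => // _; rewrite ler01 lexx.
rewrite sum_moves !move_probE /exit_weight /= !mul1r -/e.
have eE : (if (v == v) && counted (fsval x) away then y else 1) = e by [].
rewrite ?eE.
case: n sz => [|n] sz.
  rewrite /= !mulr1; have : q * e <= q.
    by apply: ler_piMr; [case/andP: q01|case/andP: e01].
  by move: (q * e) (q) => a b; lra.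
pose Wr := site_weight (awake s).[~ val x] v y.
have W m : site_weight (awake (perform x m)) v y = Wr.
  by apply/funext => c; exact: site_weight_leave.
rewrite !emissionS !kid_perform // !W /= node_average.
apply: node_le => //; try exact: kid_nonneg.
move=> c c01; rewrite [leRHS](frogs_big_split xv) ler_wpM2r ?site_weight_ge0 //.
rewrite /frog_weight /= eqxx /= -/q /e /exit_weight /= eqxx /=.
have one01 : 0 <= (1 : R) <= 1 by rewrite ler01 lexx.
by case: ifP => // _; case/andP: (step_weight_itv q01 one01 c01).
Qed.

Lemma kid_sibling m n u i : u != v -> suffix (child u i) v ->
  kid (perform x m) n u (rev_ord i) = kid s n u (rev_ord i).
Proof.
move=> nuv uiv.
have ii : rev_ord i != i.
  by case: i {uiv} => [[|[|k]] lt] //; apply/eqP => /(congr1 val).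
have nsuf w : suffix (child u i) w -> ~~ suffix (child u (rev_ord i)) w.
  move=> h; apply/negP => h'; have := suffix_same_size h' h erefl.
  by case=> /eqP; rewrite (negbTE ii).
have down j : suffix (child u i) (child v j).
  by apply: suffix_trans uiv _; exact: suffix_cons.
rewrite /kid (visited_perform ws xv).
have -> : (child u (rev_ord i) \in
    if m is Some j then child v j |` visited s else visited s) =
    (child u (rev_ord i) \in visited s).
  case: m => // j; rewrite in_fset1U; case: eqP => // E.
  by have := nsuf _ (down j); rewrite -E suffix_refl.
case: ifP => // _; congr Some; apply: emission_other => [|_|j _ _]; try exact: nsuf.
apply/negP => h; have [E|ne] := eqVneq (child u i) v.
  by have := size_suffix h; rewrite -E /=; lia.
have [j uijv] := suffix_child uiv ne.
have := nsuf (parent v); rewrite h => /(_ _)/negP; apply => //.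
have /suffixP[l vE] := uijv.
move: vE; case: l => [|a l] vE; rewrite vE /=; first exact: suffix_refl.
exact: suffix_trans (suffix_cons j _) (suffix_suffix l _).
Qed.

(** Induction along the path from [u] down to the moving frog. A frog that leaves the child for [u]
    acquires at [u] a weight equal to the exit weight of the child at [step_weight r y c], so
    [node_linear] lifts the inequality by one level. *)
Lemma emission_super n u y : (size u + n)%N = N.+1 -> suffix u v -> u != root 2 ->
  0 <= y <= 1 ->
  \sum_m move_prob p (v, away) m *
    (exit_weight u m y * emission (perform x m) n u y) <= emission s n u y.
Proof.
elim: n u y => [|n IH] u y sz uv u0 y01.
  have [uvE|nuv] := eqVneq u v; first by rewrite uvE in sz *; exact: emission_here.
  have q01 : 0 <= q <= 1 by exact: up_prob_itv.
  by rewrite sum_moves !move_probE /exit_weight (negbTE nuv) /= !mulr1; lra.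
have [uvE|nuv] := eqVneq u v; first by rewrite uvE in sz *; exact: emission_here.
have [i uiv] := suffix_child uv nuv.
have szi : (size (child u i) + n)%N = N.+1 by rewrite /= addSnnS.
have ui : child u i \in visited s by exact: (wf_suffix ws uiv (pos_visited ws xv)).
have other m := kid_sibling m n nuv uiv.
rewrite [leRHS](emission_at i).
have -> : kid s n u i = Some (emission s n (child u i)) by rewrite /kid ui.
pose W m := site_weight (awake (perform x m)) u y.
have -> : \sum_m move_prob p (v, away) m * (exit_weight u m y *
     emission (perform x m) n.+1 u y) =
   \sum_m move_prob p (v, away) m * node n (W m)
     (Some (emission (perform x m) n (child u i))) (kid s n u (rev_ord i)) y.
  apply: eq_bigr => m _; congr (_ * _).
  rewrite /exit_weight (negbTE nuv) andFb andbF mul1r (emission_at i) other.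
  congr (node _ _ _ _ _); rewrite /kid (visited_perform ws xv).
  by case: m => [j|]; rewrite ?in_fset1U ui ?orbT.
apply: node_linear => // [|c c01|c c01].
- exact: kid_nonneg.
- exact: site_weight_ge0.
have z01 : 0 <= step_weight r y c <= 1.
  by apply: step_weight_itv => //; case/andP: r01 => /ltW -> /ltW ->.
have := IH _ _ szi uiv _ z01; move=> /(_ isT).
move=> /(ler_wpM2l (site_weight_ge0 (awake s) u y01 c01)); apply: le_trans.
rewrite mulr_sumr; apply: ler_sum => m _.
rewrite [leRHS]mulrCA; have [-> | m0] := eqVneq (move_prob p (v, away) m) 0; first by rewrite !mul0r.
suff -> : W m c = site_weight (awake s) u y c *
    exit_weight (child u i) m (step_weight r y c) by rewrite !mulrA.
have v_size : (0 < size v)%N by apply: leq_trans (size_suffix uiv).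
have [mN|mN] := eqVneq m None; last first.
  rewrite /exit_weight (negbTE mN) mulr1; apply: site_weight_other => //.
  - by move=> mN'; rewrite mN' in mN.
  - move=> j _ _; apply/eqP => uE.
    by have := size_suffix uv; rewrite uE /= ltnn.
have [uiE|ui_neq] := eqVneq (child u i) v; last first.
  rewrite /exit_weight mN (negbTE ui_neq) mulr1; apply: site_weight_other => // _.
  apply: contra ui_neq => /eqP uE; apply/eqP.
  apply: (suffix_same_size uiv (suffix_refl v)).
  by rewrite /= uE size_behead prednK.
have pvE : parent v = u by rewrite -uiE.
(* Upward moves of frogs that have moved away have probability 0, so the arriving frog has
   up-probability [r]. *)
have away0 : away = false.
  by move: m0; rewrite mN move_probE /q /up_prob; case: away => //; rewrite eqxx.
rewrite /W /site_weight mN (frogs_big_perform ws xv) (frogs_big_split xv) pvE.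
rewrite (negbTE u0) (frog_weight_off _ _ _ _ nuv) /= mul1r mulrC; congr (_ * _).
by rewrite /frog_weight /exit_weight uiE !eqxx /= away0 /up_prob.
Qed.

End Step.

End Potential.

(** * The supermartingale for the whole tree *)

(*BEGIN*)
Section Value.
Variables (R : realType) (p : R) (N : nat).
Let r := rho p.
Hypothesis r01 : 0 < r < 1.
Local Notation conf := (config 2).
Local Notation vert := (vertex 2).

(** After the first step no frog stands at the root, so an unvisited child of the root is never
    entered; this is why the default factor is 1. *)
Definition value (y : R) (s : conf) : R :=
  y ^+ root_visits s *
  (odflt (fun=> 1) (kid p N s N (root 2) ord0) y *
   odflt (fun=> 1) (kid p N s N (root 2) ord_max) y).

Lemma value_at i (y : R) s : value y s = y ^+ root_visits s *
  (odflt (fun=> 1) (kid p N s N (root 2) i) y *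
   odflt (fun=> 1) (kid p N s N (root 2) (rev_ord i)) y).
Proof.
have [->|->] : i = ord0 \/ i = ord_max.
- by case: i => [[|[|k]] lt] //; [left|right]; exact: val_inj.
- by rewrite (_ : rev_ord ord0 = ord_max) //; exact: val_inj.
- by rewrite (_ : rev_ord ord_max = ord0) 1?[in RHS](mulrC (odflt _ _ y)) //; exact: val_inj.
Qed.

Lemma kid_ge0 s v i (y : R) : 0 <= y <= 1 -> 0 <= odflt (fun=> 1) (kid p N s N v i) y.
Proof.
move=> y01; rewrite /kid; case: ifP => _ /=; last exact: ler01.
exact: emission_ge0.
Qed.

Lemma value_ge0 (y : R) s : 0 <= y <= 1 -> 0 <= value y s.
Proof.
by move=> y01; rewrite mulr_ge0 ?exprn_ge0 ?mulr_ge0 ?kid_ge0 //; case/andP: y01.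
Qed.

Lemma value_super (y : R) s (x : domf (awake s)) : 0 <= y <= 1 -> well_formed s ->
  \sum_m move_prob p (awake s x) m * value y (perform x m) <= value y s.
Proof.
move=> y01 ws; case xv : (awake s x) => [v away].
have v0 := pos_neq_root ws xv.
have [|i iv] := @suffix_child 2 (root 2) v (suffix0s v); first by rewrite eq_sym.
have v0' : root 2 != v by rewrite eq_sym.
have iE := emission_super r01 ws xv (n := N) (u := child (root 2) i) erefl iv isT y01.
rewrite (value_at i).
have vis : child (root 2) i \in visited s.
  exact: wf_suffix ws iv (pos_visited ws xv).
have kidE m : kid p N (perform x m) N (root 2) i =
    Some (emission p N (perform x m) N (child (root 2) i)).
  rewrite /kid (visited_perform ws xv); case: m => [j|]; rewrite ?in_fset1U vis //.
  by rewrite orbT.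
have -> : kid p N s N (root 2) i = Some (emission p N s N (child (root 2) i)).
  by rewrite /kid vis.
set o := odflt _ (kid p N s N (root 2) (rev_ord i)) y.
have o0 : 0 <= o by exact: kid_ge0.
have y0 : 0 <= y by case/andP: y01.
have h := ler_wpM2l (mulr_ge0 (exprn_ge0 (root_visits s) y0) o0) iE.
rewrite [odflt _ _]/= (mulrC _ o) [leRHS]mulrA; apply: le_trans h.
rewrite mulr_sumr; apply: ler_sum => m _.
rewrite (value_at i) kidE (kid_sibling N r01 ws xv m N v0' iv) // -/o [odflt _ (Some _)]/=.
rewrite [leRHS]mulrCA; apply: ler_wpM2l.
  by rewrite (move_probE p ws xv); case: m => [j|]; have := up_prob_itv r01 away; lra.
set em := emission _ _ _ _ _ _; set ex := exit_weight _ _ _ _ _ _ _.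
have -> : y ^+ root_visits s * o * (ex * em) = y ^+ root_visits s * ex * (em * o).
  by ring.
apply: ler_wpM2r; first by rewrite mulr_ge0 // emission_ge0.
rewrite {}/ex {em}.
rewrite /exit_weight; case: m => [j|] /=.
  by rewrite mulr1 (perform_down xv); case: ifP.
rewrite (perform_up ws xv).
have -> : (parent v == root 2) = ([:: i] == v).
  apply/eqP/eqP => [pv|<- //].
  apply: (suffix_same_size iv (suffix_refl v)) => /=.
  by case: (v) v0 pv => // a l _ /= ->.
case: eqP => /= _; last by rewrite mulr1.
case: ifP => _; first by rewrite exprSr.
(* A visit by an uncounted frog is not foreseen by the emission; it only lowers the value, as
   [y <= 1]. *)
by rewrite mulr1 exprSr ler_piMr ?exprn_ge0 //; case/andP: y01.
Qed.

(** * Relevant frogs and a bound on the number of their moves *)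

Definition active (s : conf) : bool :=
  [exists x : domf (awake s), counted N (val x) (awake s x).2 &&
                              (size (awake s x).1 <= N)%N].

Lemma value_inactive (y : R) s : 0 <= y <= 1 -> ~~ active s ->
  value y s = y ^+ root_visits s.
Proof.
move=> y01 /existsPn quiet.
have kid1 i : odflt (fun=> 1) (kid p N s N (root 2) i) y = 1.
  rewrite /kid; case: ifP => //= _; apply: emission_quiet => // x u away xu cx.
  have xs : x \in domf (awake s) by rewrite -fndSome xu.
  have := quiet [` xs]; have -> : awake s [` xs] = (u, away).
    by move: xu; rewrite (in_fnd xs) => -[].
  by rewrite /= cx /= -ltnNge.
by rewrite /value !kid1 !mulr1.
Qed.

Lemma value_le_active (y : R) s : 0 <= y <= 1 ->
  y ^+ root_visits s <= value y s + (active s)%:R.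
Proof.
move=> y01; case: (boolP (active s)) => [_|/value_inactive -> //]; last by rewrite addr0.
apply: le_trans (_ : 1 <= _); last by rewrite lerDr value_ge0.
by case/andP: y01 => ? ?; exact: exprn_ile1.
Qed.

Fixpoint small (n : nat) : seq vert :=
  if n is m.+1 then root 2 :: [seq child v i | v <- small m, i <- [:: ord0; ord_max]]
  else [:: root 2].

Lemma mem_small n v : (size v <= n)%N -> v \in small n.
Proof.
elim: n v => [|n IH] [|i v] //= sz.
rewrite in_cons; apply/orP; right; apply/flattenP.
exists [:: child v ord0; child v ord_max]; first by apply/mapP; exists v => //; exact: IH.
by case: i sz => [[|[|k]] lt] // _; rewrite !inE /child !eqseq_cons eqxx !andbT.
Qed.

(** A frog moving away makes one move per level down to depth [N]; before that it may climb
    [size a.1] levels. Frogs from below depth [N] get 0 until they move away; the unvisited vertex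
    they then enter pays for them. *)
Definition stamina (x : vert) (a : vert * bool) : nat :=
  if a.2 then (N.+1 - size a.1)%N
  else if (size x <= N)%N then (N.+1 + size a.1)%N else 0%N.

(* An upper bound on the number of moves still to be made at depth at most [N] by
   counted frogs. The weight of a small unvisited vertex pays for its sleeping
   frog and for the frog that enters it. *)
Definition energy (s : conf) : nat :=
  (2 * N + 3) * count [pred v | v \notin visited s] (small N) +
  frogs_big addn stamina (awake s).

(** At an unvisited vertex of depth [k <= N] the woken frog has stamina [N + 1 + k] and the entering
    one [N + 1 - k], together less than the released [2 * N + 3]. Below depth [N] both have stamina
    0. *)
Lemma energy_perform s (x : domf (awake s)) v away m :
  well_formed s -> awake s x = (v, away) -> move_prob p (v, away) m != 0 ->
  (energy (perform x m) + (counted N (val x) away && (size v <= N)) <= energy s)%N.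
Proof.
move=> ws xv; rewrite (move_probE p ws xv) => m0.
have v0 : (0 < size v)%N by have := pos_neq_root ws xv; case: (v).
rewrite /energy (frogs_big_perform ws xv) (frogs_big_split xv) (visited_perform ws xv) /=.
set rest := frogs_big _ _ _.
case: m m0 => [i|] m0.
  case: ifP => [vi|/negbT vi].
    have -> : child v i |` visited s = visited s.
      by apply/fsetP => w; rewrite in_fset1U; case: eqP => // ->.
    by rewrite /counted /stamina /=; case: away {xv m0} => /=; last case: ifP; lia.
  set C := count _ _; set C' := count _ _.
  have CC : (C + (size (child v i) <= N) <= C')%N.
    rewrite /C /C'; have : forall l : seq vert,
      (count [pred w | w \notin child v i |` visited s] l + (child v i \in l) <=
       count [pred w | w \notin visited s] l)%N.
      elim=> //= w l IH; rewrite in_cons in_fset1U negb_or [child v i == w]eq_sym.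
      by case: eqP => [->|_] /=; rewrite ?vi; lia.
    move/(_ (small N)); apply: leq_trans; rewrite leq_add2l.
    by case: (leqP (size (child v i)) N) => // /mem_small ->.
  have : ((2 * N + 3) * C + (2 * N + 3) * (size (child v i) <= N) <=
          (2 * N + 3) * C')%N by rewrite -mulnDr leq_mul2l CC orbT.
  rewrite /counted /stamina /= {CC}; move: (_ * C)%N (_ * C')%N => a a'.
  case: (ltnP (size v) N) => szv; rewrite ?muln1 ?muln0;
  case: (leqP (size v) N) => szv'; case: away {xv m0} => /=;
  by try case: (leqP (size (fsval x)) N) => szx; lia.
have {m0} -> : away = false.
  by move: m0; rewrite /up_prob; case: away {xv} => //; rewrite eqxx.
rewrite /stamina /counted /= size_behead.
by case: ifP => _; case: (leqP (size (fsval x)) N) => szx;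
  case: (leqP (size v) N) => szv /=; lia.
Qed.

End Value.

(*BEGIN*)
(** * Expectations along the chain *)

Section Tick.
Variables (R : realType) (p : R).
Hypothesis r01 : 0 < rho p < 1.
Local Notation conf := (config 2).
Implicit Types (Phi Psi : conf -> R) (s : conf).

(** The transition operator of the chain acting on functions; its powers [expect] give expectations
    as functions of the starting configuration. *)
Definition tick Phi s : R :=
  if domf (awake s) == fset0 then Phi s
  else \sum_(x : domf (awake s)) #|` domf (awake s)|%:R^-1 *
         \sum_(m : option 'I_2) move_prob p (awake s x) m * Phi (perform x m).

Definition expect (n : nat) Phi : conf -> R := iter n tick Phi.

Lemma move_prob_ge0 (f : vertex 2 * bool) m : 0 <= move_prob p f m.
Proof.
have /andP[? ?] := r01; case: f => v away; rewrite /move_prob.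
case: ifP => _; case: m => [i|]; rewrite ?invr_ge0 ?ler0n //; last lra.
by apply: mulr_ge0; [lra|rewrite invr_ge0 ler0n].
Qed.

Lemma move_prob_sum (f : vertex 2 * bool) : \sum_m move_prob p f m = 1.
Proof. by case: f => v away; rewrite sum_moves /move_prob; case: ifP => _; field. Qed.

Lemma card_awake_gt0 s : domf (awake s) != fset0 -> (0 < #|` domf (awake s)|)%N.
Proof. by rewrite cardfs_gt0. Qed.

Lemma sum_awake_const s (c : R) : domf (awake s) != fset0 ->
  \sum_(x : domf (awake s)) #|` domf (awake s)|%:R^-1 * c = c.
Proof.
move=> /card_awake_gt0 c0.
by rewrite sumr_const -cardfE -[LHS]mulr_natl mulrA mulfV ?mul1r // pnatr_eq0 -lt0n.
Qed.

Lemma tick_le_sum s Phi (h : domf (awake s) -> R) (c : R) :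
  (domf (awake s) = fset0 -> Phi s <= c) ->
  (domf (awake s) != fset0 ->
     \sum_x #|` domf (awake s)|%:R^-1 * h x <= c) ->
  (forall x, \sum_m move_prob p (awake s x) m * Phi (perform x m) <= h x) ->
  tick Phi s <= c.
Proof.
move=> empty nonempty H; rewrite /tick; case: ifP => [/eqP/empty //|/negbT/nonempty].
by apply: le_trans; apply: ler_sum => x _; rewrite ler_wpM2l ?invr_ge0 ?ler0n.
Qed.

Lemma tick_le_const s Phi (c : R) :
  (domf (awake s) = fset0 -> Phi s <= c) ->
  (forall x, \sum_m move_prob p (awake s x) m * Phi (perform x m) <= c) ->
  tick Phi s <= c.
Proof.
move=> empty H; apply: (tick_le_sum (h := fun=> c)) => // /sum_awake_const.
by move/(_ c) => ->.
Qed.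

Lemma sum_moves_le_const (f : vertex 2 * bool) (h : option 'I_2 -> R) (c : R) :
  (forall m, move_prob p f m != 0 -> h m <= c) ->
  \sum_m move_prob p f m * h m <= c.
Proof.
move=> H; rewrite -[leRHS]mul1r -(move_prob_sum f) mulr_suml.
apply: ler_sum => m _; have [-> | m0] := eqVneq (move_prob p f m) 0.
  by rewrite !mul0r.
by rewrite ler_wpM2l ?move_prob_ge0 ?H.
Qed.

Lemma tick_le s Phi Psi :
  (domf (awake s) = fset0 -> Phi s <= Psi s) ->
  (forall (x : domf (awake s)) m, Phi (perform x m) <= Psi (perform x m)) ->
  tick Phi s <= tick Psi s.
Proof.
move=> empty H; rewrite /tick; case: ifP => [/eqP/empty //|_].
apply: ler_sum => x _; rewrite ler_wpM2l ?invr_ge0 ?ler0n //.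
by apply: ler_sum => m _; rewrite ler_wpM2l ?move_prob_ge0.
Qed.

Lemma tick_linear Phi Psi (c : R) s :
  tick (fun s => Phi s + c * Psi s) s = tick Phi s + c * tick Psi s.
Proof.
rewrite /tick; case: ifP => // _; rewrite mulr_sumr -[RHS]big_split /=.
apply: eq_bigr => x _; rewrite mulrCA -mulrDr; congr (_ * _).
rewrite mulr_sumr -big_split /=; apply: eq_bigr => m _; ring.
Qed.

Lemma expect_linear n Phi Psi (c : R) :
  expect n (fun s => Phi s + c * Psi s) =
  (fun s => expect n Phi s + c * expect n Psi s).
Proof.
by elim: n => //= n ->; apply/funext => s; exact: tick_linear.
Qed.

Lemma expect_ge0 n Phi s : (forall s, 0 <= Phi s) -> 0 <= expect n Phi s.
Proof.
move=> H; elim: n s => [|n IH] s //=; rewrite /tick; case: ifP => // _.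
apply: sumr_ge0 => x _; rewrite mulr_ge0 ?invr_ge0 ?ler0n //.
by apply: sumr_ge0 => m _; rewrite mulr_ge0 ?move_prob_ge0.
Qed.

(** The comparison is restricted to configurations that can occur after [n] steps: each step
    preserves [well_formed] and wakes at most one frog. *)
Lemma expect_le n k Phi Psi :
  (forall s, well_formed s -> (#|` domf (awake s)| <= k + n)%N -> Phi s <= Psi s) ->
  forall s, well_formed s -> (#|` domf (awake s)| <= k)%N ->
  expect n Phi s <= expect n Psi s.
Proof.
elim: n k Phi Psi => [|n IH] k Phi Psi H s ws sk /=.
  by apply: H; rewrite ?addn0.
apply: tick_le => [_|x m].
  by apply: (IH k) => // s' ws' sk'; apply: H => //; lia.
case xv : (awake s x) => [v away].
apply: (IH k.+1) => [s' ws' sk'||]; first by apply: H => //; lia.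
  exact: wf_perform ws xv m.
by have := card_awake_perform ws xv m; lia.
Qed.

Lemma expect_super n Phi :
  (forall s, well_formed s -> tick Phi s <= Phi s) ->
  forall s, well_formed s -> expect n.+1 Phi s <= expect n Phi s.
Proof.
move=> H s ws; rewrite /expect iterSr.
by apply: (@expect_le n #|` domf (awake s)|) => // s' ws' _; exact: H.
Qed.

Lemma expect_super_le n n' Phi : (n <= n')%N ->
  (forall s, well_formed s -> tick Phi s <= Phi s) ->
  forall s, well_formed s -> expect n' Phi s <= expect n Phi s.
Proof.
move=> /subnK <- H s ws; elim: (n' - n)%N => // k IH.
by rewrite addSn; apply: le_trans IH; exact: expect_super.
Qed.

Lemma tick_visits (y : R) s : 0 <= y <= 1 -> well_formed s ->
  tick (fun s => y ^+ root_visits s) s <= y ^+ root_visits s.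
Proof.
move=> /andP[y0 y1] ws; apply: tick_le_const => // x; apply: sum_moves_le_const => m _.
case xv : (awake s x) => [v away].
by apply: ler_wiXn2l => //; exact: root_visits_perform ws xv m.
Qed.

Lemma tick_value N (y : R) s : 0 <= y <= 1 -> well_formed s ->
  tick (value p N y) s <= value p N y s.
Proof. by move=> y01 ws; apply: tick_le_const => // x; exact: value_super. Qed.

(** If the configuration is active, some relevant frog is selected with probability at least
    [1 / k], and its move costs a unit of energy. *)
Lemma tick_energy N s k : well_formed s -> (#|` domf (awake s)| <= k)%N -> (0 < k)%N ->
  tick (fun s => (energy N s)%:R) s + k%:R^-1 * (active N s)%:R <= (energy N s)%:R.
Proof.
move=> ws sk k0; rewrite -lerBrDr.
pose a (x : domf (awake s)) : bool :=
  counted N (val x) (awake s x).2 && (size (awake s x).1 <= N)%N.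
apply: (tick_le_sum (h := fun x => (energy N s)%:R - (a x)%:R)) => [s0|s0|x].
- suff -> : active N s = false by rewrite mulr0 subr0.
  by apply/existsP => -[x _]; move: (valP x); rewrite [X in _ \in X]s0 in_fset0.
- under eq_bigr do rewrite mulrBr.
  rewrite sumrB sum_awake_const // lerB //.
  rewrite /active; case: existsP => [[x ax]|_]; last first.
    by rewrite mulr0 sumr_ge0 // => x _; rewrite mulr_ge0 ?invr_ge0 ?ler0n.
  rewrite (bigD1 x) //= /a ax !mulr1 ler_wpDr //.
    by rewrite sumr_ge0 // => z _; rewrite mulr_ge0 ?invr_ge0 ?ler0n.
  by rewrite lef_pV2 ?posrE ?ltr0n ?card_awake_gt0 ?ler_nat.
apply: sum_moves_le_const => m m0; rewrite lerBrDr -natrD ler_nat /a.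
case xv : (awake s x) m0 => [v away] m0 /=.
exact: (energy_perform N r01 ws xv m0).
Qed.

(** Telescoping of [tick_energy]: two frogs at the start leave at most [i + 2] awake at time [i]. *)
Lemma expect_active_sum N n s : well_formed s -> (#|` domf (awake s)| <= 2)%N ->
  \sum_(i < n) i.+2%:R^-1 * expect i (fun s => (active N s)%:R) s <= (energy N s)%:R.
Proof.
move=> ws s2; pose E s : R := (energy N s)%:R; pose A s : R := (active N s)%:R.
suff : expect n E s + \sum_(i < n) i.+2%:R^-1 * expect i A s <= E s.
  by apply: le_trans; rewrite lerDr expect_ge0 // => s'; exact: ler0n.
elim: n => [|n IH]; first by rewrite big_ord0 addr0.
apply: le_trans IH; rewrite big_ord_recr /= addrCA [leRHS]addrC lerD2l.
have := expect_le (n := n) (k := 2) (Phi := fun s => tick E s + n.+2%:R^-1 * A s)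
  (Psi := E).
rewrite expect_linear -[expect n (tick E)]iterSr; apply=> // s' ws' sk.
by apply: tick_energy; rewrite // addnC addn2 in sk *.
Qed.

Lemma harmonic_unbounded (C : R) : exists n, C < \sum_(i < n) i.+2%:R^-1.
Proof.
apply: contrapT => /forallNP H; apply: (@dvg_harmonic R).
apply: nondecreasing_is_cvgn.
  apply/nondecreasing_seqP => n; rewrite /series /= big_nat_recr //= lerDl.
  by rewrite invr_ge0 ler0n.
(* The 1 is the first harmonic term, absent from the sum over [i.+2]; the maximum with 0 covers the
   empty partial sum. *)
exists (1 + Num.max C 0) => _ [[|n] _ <-]; rewrite /series /=.
  by rewrite big_geq // addr_ge0 // le_max lexx orbT.
rewrite big_nat_recl // lerD //= ?invr1 // big_mkord le_max.
by have /negP := H n; rewrite -leNgt => ->.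
Qed.

Lemma expect_active_small N s (e : R) : 0 < e -> well_formed s ->
  (#|` domf (awake s)| <= 2)%N ->
  exists n, expect n (fun s => (active N s)%:R) s < e.
Proof.
move=> e0 ws s2; apply: contrapT => /forallNP H.
have [n] := harmonic_unbounded ((energy N s)%:R / e).
rewrite ltr_pdivrMr // ltNge => /negP; apply.
apply: le_trans (expect_active_sum N n ws s2).
rewrite mulr_suml; apply: ler_sum => i _; rewrite ler_wpM2l ?invr_ge0 ?ler0n //.
by rewrite leNgt; apply/negP/H.
Qed.

(** The expectation of [y ^+ root_visits] decreases in time, so one time at which activity is
    unlikely suffices; there [value] dominates up to [e], and it is a supermartingale. *)
Lemma expect_visits_le N (y e : R) s : 0 <= y <= 1 -> 0 < e -> well_formed s ->
  (#|` domf (awake s)| <= 2)%N ->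
  exists n, forall n', (n <= n')%N ->
    expect n' (fun s => y ^+ root_visits s) s <= value p N y s + e.
Proof.
move=> y01 e0 ws s2; have [n ne] := expect_active_small N e0 ws s2.
exists n => n' nn'; apply: (le_trans (expect_super_le nn' _ ws)).
  by move=> s' ws'; exact: tick_visits.
apply: (@le_trans _ _ (expect n (fun s => value p N y s + 1 * (active N s)%:R) s)).
  apply: (expect_le (k := 2)) => // s' _ _; rewrite mul1r; exact: value_le_active.
rewrite expect_linear mul1r; apply: lerD; last exact: ltW.
exact: (expect_super_le (leq0n n) (fun s' => @tick_value N y s' y01) ws).
Qed.

End Tick.

(** * The first step, and the vanishing of the expectation of [y ^+ root_visits] *)

(*BEGIN*)
Section FirstStep.
Variables (R : realType) (p : R).
Hypothesis r01 : 0 < rho p < 1.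
Local Notation conf := (config 2).

(** Written with the nested updates that [perform] produces from [init_config]. *)
Definition after_first_step (i : 'I_2) : conf :=
  Config [fmap].[root 2 <- (root 2, false)].[root 2 <- ([:: i], true)]
                .[[:: i] <- ([:: i], false)]
         ([:: i] |` [fset root 2]) 0.

Lemma awake_init (x : domf (awake (init_config 2))) :
  val x = root 2 /\ awake (init_config 2) x = (root 2, false).
Proof.
have xr : val x = root 2.
  by apply/eqP; have := valP x; rewrite [X in _ \in X]dom_setf domf0 in_fset1U in_fset0 orbF.
split=> //.
by apply: Some_inj; rewrite Some_fnd /= fnd_set xr eqxx.
Qed.

Lemma perform_init (x : domf (awake (init_config 2))) i :
  perform x (Some i) = after_first_step i.
Proof.
have [xr xv] := awake_init x.
by rewrite /perform xv /land /= xr !in_fset1.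
Qed.

Lemma dom_after_first_step i :
  domf (awake (after_first_step i)) = [:: i] |` [fset root 2].
Proof.
rewrite [LHS]dom_setf !dom_setf domf0; apply/fsetP => k.
by rewrite !in_fset1U in_fset0 in_fset1 orbF orbb.
Qed.

Lemma wf_after_first_step i : well_formed (after_first_step i).
Proof.
split.
- by rewrite in_fset1U in_fset1 eqxx orbT.
- by move=> v; rewrite !in_fset1U !in_fset1 => /orP[] /eqP -> ; rewrite ?eqxx ?orbT.
- by rewrite dom_after_first_step.
- move=> x u away; rewrite !fnd_set in_fset1U.
  case: eqP => [_ [<- _]|_]; first by rewrite eqxx.
  case: eqP => [_ [<- _]|_]; first by rewrite eqxx.
  by rewrite fnd_fmap0.
Qed.

Lemma card_after_first_step i : (#|` domf (awake (after_first_step i))| <= 2)%N.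
Proof. by rewrite dom_after_first_step cardfsU1 cardfs1 -[2%N]/(1 + 1)%N leq_add2r leq_b1. Qed.

Lemma value_after_first_step N (y : R) i :
  value p N y (after_first_step i) = gen (rho p) N y.
Proof.
have neq : rev_ord i != i.
  by case: i => [[|[|k]] lt] //; apply/eqP => /(congr1 val).
rewrite (value_at _ _ i) expr0 mul1r /kid /= !in_fset1U !in_fset1 eqxx /=.
rewrite eqseq_cons andbT (negbTE neq) /= mulr1.
rewrite emission_fresh //= => [j|z c sz].
  by rewrite !in_fset1U in_fset1 eqseq_cons andbF.
rewrite /site_weight frogs_big_new; last first.
  by rewrite !dom_setf domf0 !in_fset1U in_fset0.
rewrite frogs_big_set frogs_big_idx => [|k a].
  rewrite /frog_weight /counted /= !eqxx sz /=.
  by rewrite /step_weight; ring.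
by rewrite fnd_rem1 fnd_set; case: eqP => // _; rewrite fnd_fmap0.
Qed.

Lemma expect_mono n (Phi Psi : conf -> R) s : (forall s, Phi s <= Psi s) ->
  expect p n Phi s <= expect p n Psi s.
Proof. by move=> H; elim: n s => [|n IH] s //=; exact: tick_le. Qed.

Lemma expect_scale n (Phi : conf -> R) (c : R) s :
  expect p n (fun s => c * Phi s) s = c * expect p n Phi s.
Proof.
elim: n s => //= n IH s; have -> : expect p n (fun s => c * Phi s) =
  (fun s => c * expect p n Phi s) by exact/funext.
rewrite /tick; case: ifP => // _; rewrite mulr_sumr.
apply: eq_bigr => x _; rewrite mulrCA; congr (_ * _).
by rewrite mulr_sumr; apply: eq_bigr => m _; rewrite mulrCA.
Qed.

Lemma expect_visits_vanish n0 (y e : R) : 0 <= y < 1 -> 0 < e ->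
  (1 + rho p) / 2 * gen (rho p) n0 ((1 + rho p) / 2) < 2 - (rho p)^-1 ->
  exists n, expect p n (fun s => y ^+ root_visits s) (init_config 2) <= e.
Proof.
move=> /andP[y0 y1] e0 small; have y01 : 0 <= y <= 1 by rewrite y0 ltW.
have e20 : 0 < e / 2 by rewrite divr_gt0.
have [N genN] : exists N, gen (rho p) N y <= e / 2.
  have y01' : 0 <= y < 1 by rewrite y0.
  have [N _ /(_ N (leqnn N)) HN] := cvgr_le _ (gen_vanish r01 small y01') _ e20.
  by exists N.
have H i := expect_visits_le r01 N y01 e20 (wf_after_first_step i)
  (card_after_first_step i).
have [a Ha] := H ord0; have [b Hb] := H ord_max.
(* The maximum serves both children that the root frog may enter; the successor accounts for its
   first step. *)
exists (maxn a b).+1; apply: tick_le_const => [s0|x].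
  by have := in_fset0 (root 2); rewrite -s0 /= in_fset1U eqxx.
have [_ xv] := awake_init x; apply: sum_moves_le_const => // -[i|] m0; last first.
  by move: m0; rewrite xv /= eqxx.
rewrite perform_init; have [->|->] : i = ord0 \/ i = ord_max.
- by case: i {m0} => [[|[|k]] lt] //; [left|right]; exact: val_inj.
- apply: le_trans (Ha _ (leq_maxl a b)) _.
  by rewrite value_after_first_step; lra.
- apply: le_trans (Hb _ (leq_maxr a b)) _.
  by rewrite value_after_first_step; lra.
Qed.

End FirstStep.

Local Open Scope classical_set_scope.
Local Open Scope ring_scope.

(*BEGIN*)
Local Open Scope classical_set_scope.
Local Open Scope ring_scope.

(** * The law of the chain *)

(** Countability turns measurability of the singleton events into that of all events on [X n]. *)
HB.instance Definition _ (d : nat) :=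
  Countable.copy (config d) (can_type (@config_can d)).

Section Law.
Variables (R : realType) (p : R) (disp : measure_display)
  (T : measurableType disp) (P : probability T R) (X : nat -> T -> config 2).
Hypotheses (r01 : 0 < rho p < 1) (hX : is_RFM p P X).
Local Notation conf := (config 2).

Lemma measurable_event n (B : set conf) : measurable (X n @^-1` B).
Proof.
have -> : X n @^-1` B =
    \bigcup_k (X n @^-1` [set s | B s /\ choice.unpickle k = Some s]).
  apply/seteqP; split=> [t Bt|t [k _ []//]].
  by exists (choice.pickle (X n t)) => //; split=> //; rewrite choice.pickleK.
apply: bigcupT_measurable => k; case E : (choice.unpickle k : option conf) => [s|]; last first.
  rewrite (_ : _ @^-1` _ = set0); first exact: measurable0.
  by apply/seteqP; split=> t // -[].
have [Bs|nBs] := pselect (B s).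
  rewrite (_ : _ @^-1` _ = X n @^-1` [set s]); first exact: hX.1.
  by apply/seteqP; split=> [t /= [_ [->]]//|t /= ->]; split.
rewrite (_ : _ @^-1` _ = set0); first exact: measurable0.
by apply/seteqP; split=> t //= -[Bt [sE]]; apply: nBs; rewrite sE.
Qed.

(** One step reaches finitely many configurations, so integration against the transition
    probabilities is a finite sum. Different moves may give the same configuration, hence [undup] in
    the proof. *)
Lemma trans_prob_support (s : conf) : exists L : seq conf, uniq L /\
  forall Phi : conf -> R, \sum_(s' <- L) trans_prob p s s' * Phi s' = tick p Phi s.
Proof.
rewrite /trans_prob /tick; case: (domf (awake s) == fset0).
  by exists [:: s]; split=> // Phi; rewrite big_seq1 eqxx mul1r.
pose L := [seq perform x m | x <- enum {: domf (awake s)}, m <- enum {: option 'I_2}].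
exists (undup L); split=> [|Phi]; first exact: undup_uniq.
under eq_bigr do rewrite mulr_suml.
rewrite exchange_big; apply: eq_bigr => x _ /=.
under eq_bigr do rewrite -mulrA mulr_suml.
rewrite -mulr_sumr exchange_big; congr (_ * _); apply: eq_bigr => m _ /=.
have Lm : perform x m \in undup L.
  by rewrite mem_undup; apply/allpairsP; exists (x, m); rewrite !mem_enum.
rewrite (bigD1_seq (perform x m)) ?undup_uniq //= eqxx mulr1 big1 ?addr0 // => s' /negbTE ->.
by rewrite mulr0 mul0r.
Qed.

Lemma measure_split (Y : T -> conf) (L : seq conf) (A : set T) :
  (forall B, measurable (Y @^-1` B)) -> measurable A -> uniq L ->
  P A = (\sum_(s <- L) P (A `&` Y @^-1` [set s]) +
         P (A `&` Y @^-1` [set s | s \notin L]))%E.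
Proof.
move=> mY mA; elim: L => [|s L IH] /=.
  move=> _; rewrite big_nil add0e (_ : Y @^-1` _ = setT) ?setIT //.
  by apply/seteqP; split.
move=> /andP[sL uL]; rewrite {1}(IH uL) big_cons -addeA addeCA; congr (_ + _)%E.
set C := Y @^-1` [set s | s \notin L].
rewrite (measureDI _ (measurableI _ _ mA (mY _)) (mY [set s])) addeC.
congr (P _ + P _)%E; apply/seteqP; split=> t /=.
- move=> [[At tL] Yt]; split=> //; rewrite in_cons negb_or tL andbT.
  by apply/eqP => Ys; apply: Yt.
- by move=> [At]; rewrite in_cons negb_or => /andP[/eqP ? ?].
- by move=> [[At _] Yt].
- by move=> [At Yt]; split=> //; split=> //; rewrite Yt.
Qed.

Definition path_event n (c : nat -> conf) : set T :=
  [set t | forall i, (i <= n)%N -> X i t = c i].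

Definition path_weight n (c : nat -> conf) : R :=
  (c 0%N == init_config 2)%:R * \prod_(i < n) trans_prob p (c i) (c i.+1).

Definition extend n (c : nat -> conf) (s : conf) (i : nat) : conf :=
  if (i <= n)%N then c i else s.

Lemma path_event_extend n c s :
  path_event n c `&` X n.+1 @^-1` [set s] = path_event n.+1 (extend n c s).
Proof.
apply/seteqP; split=> [t [Ht ts] i|t Ht] /=.
  by rewrite /extend leq_eqVlt ltnS => /predU1P[->|ile]; rewrite ?ltnn // ile Ht.
split=> [i ile|] /=.
  by have := Ht i (leqW ile); rewrite /extend ile.
by have := Ht _ (leqnn n.+1); rewrite /extend ltnn.
Qed.

Lemma path_weight_extend n c s :
  path_weight n.+1 (extend n c s) = path_weight n c * trans_prob p (c n) s.
Proof.
rewrite /path_weight big_ord_recr /= {1}/extend leq0n mulrA; congr (_ * _ * _).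
- by apply: eq_bigr => i _; rewrite /extend ltn_ord ltnW // ltn_ord.
- by rewrite /extend leqnn ltnn.
Qed.

Lemma measurable_path n c : measurable (path_event n c).
Proof.
elim: n c => [|n IH] c.
  rewrite (_ : path_event 0 c = X 0%N @^-1` [set c 0%N]); first exact: measurable_event.
  apply/seteqP; split=> t /=; first exact.
  by move=> H i; rewrite leqn0 => /eqP ->.
rewrite (_ : path_event n.+1 c = path_event n c `&` X n.+1 @^-1` [set c n.+1]).
  by apply: measurableI => //; exact: measurable_event.
apply/seteqP; split=> t /=.
  by move=> H; split=> [i ile|]; apply: H => //; exact: leqW.
by move=> [H1 H2] i; rewrite leq_eqVlt ltnS => /predU1P[->//|]; exact: H1.
Qed.

(** The Markov property, by induction on [j]: the event is split according to the value of
    [X n.+1]. *)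
Lemma path_law j n c (B : set conf) :
  P (path_event n c `&` X (n + j)%N @^-1` B) =
  (path_weight n c * expect p j (fun s => (s \in B)%:R) (c n))%:E.
Proof.
have law n' c' : P (path_event n' c') = (path_weight n' c')%:E by exact: hX.2.
elim: j n c => [|j IH] n c.
  rewrite addn0 /=; case: (boolP (c n \in B)) => [/set_mem cB|cB].
    rewrite mulr1 -law; congr (P _); apply/seteqP; split=> [t []//|t Ht].
    by split=> //=; rewrite (Ht n).
  rewrite mulr0 -[RHS](measure0 P); congr (P _); apply/seteqP; split=> // t [Ht] /=.
  by rewrite (Ht n) // => /mem_set; rewrite (negbTE cB).
have [L [uL HL]] := trans_prob_support (c n).
have mX n' : forall B, measurable (X n' @^-1` B) by exact: measurable_event.
(* The transition probabilities over [L] sum to 1, so the pieces over [L] already exhaust the finite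
   mass of the path event. *)
have rest0 : P (path_event n c `&` X n.+1 @^-1` [set s | s \notin L]) = 0%E.
  have := measure_split (mX n.+1) (measurable_path n c) uL.
  under eq_bigr do rewrite path_event_extend law path_weight_extend.
  rewrite sumEFin -mulr_sumr law.
  have -> : \sum_(s <- L) trans_prob p (c n) s = 1.
    have := HL (fun=> 1); under eq_bigr do rewrite mulr1.
    move=> ->; rewrite /tick; case: ifP => // /negbT s0.
    under eq_bigr do (under eq_bigr do rewrite mulr1); rewrite /=.
    under eq_bigr do rewrite move_prob_sum //.
    exact: sum_awake_const.
  rewrite mulr1 => E; have : (P (path_event n c `&` X n.+1 @^-1` [set s | s \notin L])
    \is a fin_num)%E by rewrite fin_num_measure //; apply: measurableI => //; exact: measurable_path.
  by move: E; case: (P _) => //= z [] E _; congr _%:E; lra.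
rewrite (measure_split (mX n.+1) _ uL); last first.
  by apply: measurableI => //; exact: measurable_path.
rewrite [X in (_ + X)%E](_ : _ = 0%E) ?adde0; last first.
  apply/eqP; rewrite -measure_le0 -rest0 le_measure ?inE //.
  - by do 2?apply: measurableI => //; exact: measurable_path.
  - by apply: measurableI => //; exact: measurable_path.
  - by move=> t [[? _] ?].
have term s : P (path_event n c `&` X (n + j.+1)%N @^-1` B `&` X n.+1 @^-1` [set s]) =
    (path_weight n c * (trans_prob p (c n) s *
       expect p j (fun s => (s \in B)%:R) s))%:E.
  rewrite setIAC path_event_extend addnS -addSn IH path_weight_extend mulrA.
  by rewrite {1}/extend ltnn.
under eq_bigr do rewrite term.
by rewrite sumEFin -mulr_sumr HL.
Qed.

Lemma law_le n (B : set conf) :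
  (P (X n @^-1` B) <= (expect p n (fun s => (s \in B)%:R) (init_config 2))%:E)%E.
Proof.
pose c : nat -> conf := fun=> init_config 2.
have w1 : path_weight 0 c = 1 by rewrite /path_weight eqxx big_ord0 mulr1.
have full : P (~` path_event 0 c) = 0%E.
  rewrite probability_setC; last exact: measurable_path.
  by rewrite [P _]hX.2 -/(path_weight 0 c) w1 subee.
rewrite (measureDI _ (measurable_event n B) (measurable_path 0 c)).
rewrite [X in (X + _)%E](_ : _ = 0%E) ?add0e; last first.
  apply/eqP; rewrite -measure_le0 -full le_measure ?inE //.
  - by apply: measurableD; [exact: measurable_event|exact: measurable_path].
  - by apply: measurableC; exact: measurable_path.
have := path_law n 0 c B; rewrite add0n w1 mul1r => <-.
by rewrite classical_sets.setIC.
Qed.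

End Law.

(** Markov's inequality with [y = 1 / 2]: the probability of fewer than [k] visits by time [n] is at
    most [2 ^+ k] times the expectation of [y ^+ root_visits], which can be made arbitrarily small.
    The union over [k] is countable. *)
Lemma recurrent_small (R : realType) (p : R) n0 : 0 < rho p < 1 ->
  (1 + rho p) / 2 * gen (rho p) n0 ((1 + rho p) / 2) < 2 - (rho p)^-1 ->
  recurrent 2 p.
Proof.
move=> r01 small disp T P X hX.
pose low k : set (config 2) := [set s | (root_visits s < k)%N].
pose A k := \bigcap_n (X n @^-1` low k).
have mA k : measurable (A k).
  by apply: bigcapT_measurable => n; exact: (measurable_event hX).
apply: (@negligibleS _ _ _ _ (\bigcup_k A k)).
  move=> t /= /existsNP[k /forallNP H]; exists k => // n _ /=.
  by rewrite /low /= ltnNge; apply/negP/H.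
apply: negligible_bigcup => k; apply/(negligibleP _ (mA k)).
apply/eqP; rewrite -measure_le0; apply/lee_addgt0Pr => e e0; rewrite add0e.
have e'0 : 0 < 2^-1 ^+ k * e :> R by rewrite mulr_gt0 ?exprn_gt0.
have h01 : 0 <= (2^-1 : R) < 1 by lra.
have [n Hn] := expect_visits_vanish r01 h01 e'0 small.
apply: (@le_trans _ _ (P (X n @^-1` low k))).
  rewrite le_measure ?inE //; first exact: (measurable_event hX).
  by move=> t; apply.
apply: (le_trans (law_le hX n (low k))); rewrite lee_fin.
apply: (@le_trans _ _ (2 ^+ k * (2^-1 ^+ k * e))); last first.
  by rewrite mulrA -exprMn mulfV // expr1n mul1r.
apply: le_trans (ler_wpM2l _ Hn); last by rewrite exprn_ge0.
rewrite -expect_scale; apply: (expect_mono r01) => s.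
case: (boolP (s \in low k)) => [/set_mem/= sk|_]; last by rewrite mulr_ge0 ?exprn_ge0.
rewrite -(subnK (ltnW sk)) exprD -mulrA -exprMn mulfV // expr1n mulr1.
by rewrite exprn_ege1 // ler1n.
Qed.

Theorem proposition4 (R : realType) :
  (critical_drift R 2 <= (4155 / 10000)%:E)%E.
Proof.
pose p : R := 71 / 171.
have rE : rho p = 71 / 100.
  by rewrite /rho /p ifT; [field|lra].
apply: (@le_trans _ _ p%:E); last by rewrite lee_fin /p; lra.
apply: ereal_inf_lbound; exists p => //; split; first by rewrite /p; lra.
apply: recurrent_small (gen_small rE).
by rewrite rE; lra.
Qed.
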